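(* For every sufficiently large population size $N$ there exists a connected, undirected, edge-weighted graph $A_N$ on $N$ nodes such that for all $r\in(1,1.2)$, \[ \rho^{\mathrm{Bd}}_r(A_N)>\rho^{\mathrm{Bd}}_r(K_N)\quad\text{and}\quad \rho^{\mathrm{dB}}_r(A_N)>\rho^{\mathrm{dB}}_r(K_N). \]
   Context: Each edge $\{u,v\}$ has a positive weight $w(u,v)$ and $\deg(u)=\sum_v w(u,v)$. Each node is occupied by a resident (fitness 1) or a mutant (fitness $r\ge1$); $f(u)$ is the fitness at $u$, $F=\sum_u f(u)$. Moran Birth-death (Bd) process: each step a node $u$ is chosen with probability $f(u)/F$ and its offspring replaces a neighbor $v$ chosen with probability $w(u,v)/\deg(u)$. Moran death-Birth (dB) process: each step a uniformly random node $v$ dies and is replaced by the offspring of a neighbor $u$ chosen with probability $f(u)w(u,v)/\sum_{u'}f(u')w(u',v)$. For a graph $G_N$ and process $p$, $\rho^p_r(G_N)=\frac1N\sum_{v}\rho^p_r(G_N,\{v\})$, where $\rho^p_r(G_N,\{v\})$ is the probability that mutants eventually occupy all nodes when initially only $v$ is a mutant. $K_N$ is the unweighted complete graph on $N$ nodes, for which $\rho^{\mathrm{Bd}}_r(K_N)=\frac{1-1/r}{1-1/r^N}$ and $\rho^{\mathrm{dB}}_r(K_N)=\frac{N-1}{N}\cdot\frac{1-1/r}{1-1/r^{N-1}}$. *)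

(* Defs.v *)
From HB Require Import structures.
From mathcomp Require Import all_boot all_order all_algebra.
From mathcomp Require Import all_classical all_reals all_analysis.
Set Implicit Arguments. Unset Strict Implicit. Unset Printing Implicit Defensive.
Import Order.TTheory GRing.Theory Num.Theory.
Import numFieldNormedType.Exports.
Local Open Scope ring_scope.

Section Moran.
Variables (R : realType) (N : nat).

(* An edge-weighted graph on the node set 'I_N is given by a weight function:
   w u v > 0 iff {u,v} is an edge (with weight w u v), w u v = 0 otherwise. *)
Definition weighted_graph (w : 'I_N -> 'I_N -> R) : Prop :=
  (forall u v, 0 <= w u v) /\ (forall u v, w u v = w v u) /\ (forall u, w u u = 0).

Definition connected_wg (w : 'I_N -> 'I_N -> R) : Prop :=
  forall u v : 'I_N, connect (fun x y => 0 < w x y) u v.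

Definition complete_w : 'I_N -> 'I_N -> R := fun u v => if u == v then 0 else 1.

Definition wdeg (w : 'I_N -> 'I_N -> R) (u : 'I_N) : R := \sum_(v < N) w u v.

(* fitness of node u when S is the set of mutant nodes *)
Definition fit (r : R) (S : {set 'I_N}) (u : 'I_N) : R := if u \in S then r else 1.

Definition total_fit (r : R) (S : {set 'I_N}) : R := \sum_(u < N) fit r S u.

Definition repl (S : {set 'I_N}) (u v : 'I_N) : {set 'I_N} :=
  if u \in S then v |: S else S :\ v.

Definition Bd_step (r : R) (w : 'I_N -> 'I_N -> R) (g : {set 'I_N} -> R)
    (S : {set 'I_N}) : R :=
  \sum_(u < N) \sum_(v < N)
     (fit r S u / total_fit r S) * (w u v / wdeg w u) * g (repl S u v).

Definition dB_step (r : R) (w : 'I_N -> 'I_N -> R) (g : {set 'I_N} -> R)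
    (S : {set 'I_N}) : R :=
  \sum_(v < N) N%:R^-1 * \sum_(u < N)
     (fit r S u * w u v / \sum_(u' < N) fit r S u' * w u' v) * g (repl S u v).

Fixpoint n_step_fix (step : ({set 'I_N} -> R) -> {set 'I_N} -> R) (n : nat)
    : {set 'I_N} -> R :=
  match n with
  | 0 => fun S => if S == [set: 'I_N]%SET then 1 else 0
  | n'.+1 => step (n_step_fix step n')
  end.

(* fixation probability from initial mutant set S (all-mutant state is absorbing) *)
Definition fixprob (step : ({set 'I_N} -> R) -> {set 'I_N} -> R) (S : {set 'I_N}) : R :=
  limn (fun n => n_step_fix step n S).

Definition rho_Bd (r : R) (w : 'I_N -> 'I_N -> R) : R :=
  N%:R^-1 * \sum_(v < N) fixprob (Bd_step r w) [set v].

Definition rho_dB (r : R) (w : 'I_N -> 'I_N -> R) : R :=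
  N%:R^-1 * \sum_(v < N) fixprob (dB_step r w) [set v].

End Moran.

(* Main.v *)
Require Import Defs.
From HB Require Import structures.
From mathcomp Require Import all_boot all_order all_algebra.
From mathcomp Require Import all_classical all_reals all_analysis.
From mathcomp Require Import ring lra zify.
Set Implicit Arguments. Unset Strict Implicit. Unset Printing Implicit Defensive.
Import Order.TTheory GRing.Theory Num.Theory.
Import numFieldNormedType.Exports.
Local Open Scope ring_scope.

(**
Bridging the two update rules requires a population with two kinds of small
islands around a common hub.  The hub is a clique of [m] nodes; about half of the
remaining nodes form pairs of degree [1], the other half pairs of degree [L ^ 2],
while hub nodes have degree [L]; hub and pairs are joined by edges of a tiny weight
[eps].  The reproductive value of a node is inversely proportional to its degree for
Bd and proportional to it for dB, so the low-degree pairs carry essentially all of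
it in the first process and the high-degree pairs in the second.  These "main" pairs
communicate through the hub, where each invasion attempt is decided in favour of the
fitter type; a mutant pair therefore behaves as a single individual of relative
fitness at least [1 + 40 (r - 1)], which outweighs the loss of half of the population
and of half of the single mutants inside a pair.

This is made rigorous by a potential [psi S], a product over the islands of a function
of the number of mutants in the island.  First order terms in [r - 1] cancel along
every edge because the increments of [psi] are proportional to reproductive values.
At second order, an edge between homogeneous islands contributes nonpositively, edges
inside a mixed island contribute a definite negative amount, and this dominates
all other edges since [eps] is tiny.  Thus [psi] is superharmonic for both processes and
[(1 - psi S) / (1 - psi setT)] bounds the fixation probability from below,
uniformly in [r], including [r] close to [1].  On the complete graph,
[(1 - r ^ - |S|) / (1 - r ^ - N)] is superharmonic for both processes.
*)

(** * Fixation probabilities and harmonic functions *)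

Section MarkovChain.
Variables (R : realType) (N : nat).
Implicit Types (S : {set 'I_N}) (g h : {set 'I_N} -> R) (u v : 'I_N).
Variable p : {set 'I_N} -> 'I_N -> 'I_N -> R.

Definition repl_step g S : R := \sum_(u < N) \sum_(v < N) p S u v * g (repl S u v).

Hypothesis p_ge0 : forall S u v, 0 <= p S u v.
Hypothesis p_sum1 : forall S, \sum_(u < N) \sum_(v < N) p S u v = 1.

Lemma repl_step_le g h S : (forall S', g S' <= h S') -> repl_step g S <= repl_step h S.
Proof. by move=> gh; do 2![apply: ler_sum => ? _]; apply: ler_wpM2l. Qed.

Lemma repl_step_cst (k : R) S : repl_step (fun=> k) S = k.
Proof.
rewrite /repl_step; under eq_bigr do rewrite -mulr_suml.
by rewrite -mulr_suml p_sum1 mul1r.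
Qed.

Lemma repl_same S u v : (u \in S) = (v \in S) -> repl S u v = S.
Proof.
rewrite /repl; case: ifP => uS vS; apply/setP => x; rewrite !inE.
  by case: eqP => // ->; rewrite -vS.
by case: eqP => // ->; rewrite -vS.
Qed.

Lemma repl_stepB g S : repl_step g S - g S =
  \sum_(u in S) \sum_(v in ~: S)
    (p S u v * (g (v |: S) - g S) + p S v u * (g (S :\ u) - g S)).
Proof.
have -> : repl_step g S - g S =
    \sum_(u < N) \sum_(v < N) p S u v * (g (repl S u v) - g S).
  rewrite -[X in _ - X](repl_step_cst (g S) S) /repl_step -sumrB.
  by apply: eq_bigr => u _; rewrite -sumrB; apply: eq_bigr => v _; rewrite mulrBr.
transitivity (\sum_(u in S) \sum_(v in ~: S) p S u v * (g (v |: S) - g S)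
   + \sum_(v in ~: S) \sum_(u in S) p S v u * (g (S :\ u) - g S)); last first.
  rewrite [X in _ + X]exchange_big -big_split; apply: eq_bigr => u _.
  by rewrite -big_split.
rewrite (bigID (mem S)) /=; congr (_ + _).
  apply: eq_bigr => u uS; rewrite (bigID (mem S)) /= big1 ?add0r.
    by apply: eq_big => [v|v vS]; rewrite ?inE // /repl uS.
  by move=> v vS; rewrite repl_same ?subrr ?mulr0 // uS vS.
apply: eq_big => [u|u uS]; first by rewrite inE.
rewrite (bigID (mem S)) /= addrC big1 ?add0r.
  by apply: eq_bigr => v vS; rewrite /repl (negbTE uS).
by move=> v vS; rewrite repl_same ?subrr ?mulr0 // (negbTE uS) (negbTE vS).
Qed.

Lemma repl_step_setT g : repl_step g [set: 'I_N]%SET = g [set: 'I_N]%SET.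
Proof.
apply/eqP; rewrite -subr_eq0 repl_stepB big1 // => u _.
by rewrite big1 // => v; rewrite !inE.
Qed.

Lemma repl_step_set0 g : repl_step g finset.set0 = g finset.set0.
Proof.
by apply/eqP; rewrite -subr_eq0 repl_stepB big1 // => u; rewrite inE.
Qed.

Let f_ n S := n_step_fix repl_step n S.

Lemma n_step_fix_ge0 n S : 0 <= f_ n S.
Proof.
elim: n S => [|n IH] S; first by rewrite /f_ /=; case: ifP.
rewrite -[X in X <= _](repl_step_cst 0 S) /f_ /=.
exact: (repl_step_le (g := fun=> 0)).
Qed.

Lemma n_step_fix_superharmonic h :
  (forall S, 0 <= h S) -> 1 <= h [set: 'I_N]%SET ->
  (forall S, repl_step h S <= h S) -> forall n S, f_ n S <= h S.
Proof.
move=> h0 h1 hh; elim=> [|n IH] S; first by rewrite /f_ /=; case: eqP => [->|].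
by apply: le_trans (hh S); rewrite /f_ /=; apply: repl_step_le.
Qed.

Lemma n_step_fix_le1 n S : f_ n S <= 1.
Proof.
apply: (@n_step_fix_superharmonic (fun=> 1)) => // S'.
by rewrite repl_step_cst.
Qed.

Lemma n_step_fix_setT n : f_ n [set: 'I_N]%SET = 1.
Proof. by elim: n => [|n IH]; rewrite /f_ /= ?eqxx // repl_step_setT. Qed.

Lemma n_step_fix_set0 n : (0 < N)%N -> f_ n finset.set0 = 0.
Proof.
move=> N0; elim: n => [|n IH]; rewrite /f_ /= ?repl_step_set0 //.
case: eqP => // /setP /(_ (Ordinal N0)); by rewrite !inE.
Qed.

Lemma n_step_fix_nondecreasing S : nondecreasing_seq (f_ ^~ S).
Proof.
apply/nondecreasing_seqP => n; elim: n S => [|n IH] S.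
  rewrite /f_ /=; case: eqP => [->|_]; last exact: (n_step_fix_ge0 1).
  by rewrite repl_step_setT eqxx.
by rewrite /f_ /=; apply: repl_step_le.
Qed.

Lemma cvg_n_step_fix S : (f_ ^~ S @ \oo --> fixprob repl_step S)%classic.
Proof.
apply: nondecreasing_is_cvgn; first exact: n_step_fix_nondecreasing.
by exists 1 => _ [n _ <-]; apply: n_step_fix_le1.
Qed.

Lemma fixprob_superharmonic h :
  (forall S, 0 <= h S) -> 1 <= h [set: 'I_N]%SET ->
  (forall S, repl_step h S <= h S) -> forall S, fixprob repl_step S <= h S.
Proof.
move=> h0 h1 hh S; apply: (cvgr_to_le (@cvg_n_step_fix S)).
by near=> n; apply: n_step_fix_superharmonic.
Unshelve. all: by end_near. Qed.

Lemma fixprob_harmonic S : repl_step (fixprob repl_step) S = fixprob repl_step S.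
Proof.
have H1 : (f_ n.+1 S @[n --> \oo] --> fixprob repl_step S)%classic.
  by have := @cvg_n_step_fix S; rewrite -(cvg_shiftS (f_ ^~ S)).
have H2 : (f_ n.+1 S @[n --> \oo] --> repl_step (fixprob repl_step) S)%classic.
  rewrite /f_ /= /repl_step; apply: cvg_big => [|u _]; first exact: add_continuous.
  apply: cvg_big => [|v _]; first exact: add_continuous.
  by apply: cvgM; [exact: cvg_cst | exact: cvg_n_step_fix].
exact: (cvg_unique _ H2 H1).
Qed.

(* Maximum principle: the maximum of [h - fixprob] propagates from a mixed state
   to larger and larger mutant sets, hence to the full one. *)
Lemma fixprob_subharmonic h :
  (0 < N)%N ->
  (forall S, S != finset.set0 -> S != [set: 'I_N]%SET ->
     exists u v, [/\ u \in S, v \notin S & 0 < p S u v]) ->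
  h finset.set0 <= 0 -> h [set: 'I_N]%SET <= 1 ->
  (forall S, h S <= repl_step h S) -> forall S, h S <= fixprob repl_step S.
Proof.
move=> N0 irr h0 h1 hh.
pose D S := h S - fixprob repl_step S.
have fT : fixprob repl_step [set: 'I_N]%SET = 1.
  apply/cvg_lim => //; under eq_fun do rewrite -/(f_ _ _) n_step_fix_setT.
  exact: cvg_cst.
have f0 : fixprob repl_step finset.set0 = 0.
  apply/cvg_lim => //; under eq_fun do rewrite -/(f_ _ _) n_step_fix_set0 //.
  exact: cvg_cst.
have DD S : D S <= repl_step D S.
  have -> : repl_step D S = repl_step h S - fixprob repl_step S.
    rewrite -fixprob_harmonic /repl_step -sumrB; apply: eq_bigr => u _.
    by rewrite -sumrB; apply: eq_bigr => v _; rewrite mulrBr.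
  by rewrite lerB.
pose S0 := [arg max_(S > (finset.set0 : {set 'I_N})) D S]%O.
have S0max S : D S <= D S0.
  by rewrite /S0; case: (@Order.TotalTheory.arg_maxP _ _ _ finset.set0 xpredT D) => // T _; apply.
suff D0 : D S0 <= 0 by move=> S; rewrite -subr_le0 (le_trans (S0max S)).
clearbody S0; have [k] := ubnP (N - #|S0|)%N; elim: k => // k IH in S0 S0max *.
move=> ltk.
have [->|S0n0] := eqVneq S0 finset.set0; first by rewrite /D f0 subr0.
have [->|S0nT] := eqVneq S0 [set: 'I_N]%SET; first by rewrite /D fT subr_le0.
have [u [v [uS vS puv]]] := irr S0 S0n0 S0nT.
have Dv : D (v |: S0) = D S0.
  apply/eqP; rewrite eq_le S0max /= leNgt; apply/negP => lt.
  have : repl_step D S0 < D S0.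
    rewrite -subr_lt0 repl_stepB (bigD1 u) //= (bigD1 v) ?inE //=.
    have le0 x y : p S0 x y * (D (y |: S0) - D S0) + p S0 y x * (D (S0 :\ x) - D S0) <= 0.
      by rewrite -[leRHS]addr0 lerD // mulr_ge0_le0 // subr_le0.
    have lt0 : p S0 u v * (D (v |: S0) - D S0) + p S0 v u * (D (S0 :\ u) - D S0) < 0.
      rewrite ltr_wnDr //; last by rewrite pmulr_rlt0 // subr_lt0.
      by rewrite mulr_ge0_le0 // subr_le0.
    rewrite ltr_wnDr //; last first.
      by rewrite ltr_wnDr //; apply: sumr_le0 => y _.
    by apply: sumr_le0 => x _; apply: sumr_le0 => y _.
  by rewrite ltNge DD.
rewrite -Dv; apply: IH => [S|]; first by rewrite Dv.
rewrite cardsU1 vS add1n.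
have : (#|S0| < N)%N by rewrite -[ltnRHS]card_ord -cardsT proper_card ?properT.
move: ltk; lia.
Qed.

End MarkovChain.

Section Kernels.
Variables (R : realType) (N : nat).
Implicit Types (S : {set 'I_N}) (u v : 'I_N).

Lemma geometric_superharmonic (r : R) (p : {set 'I_N} -> 'I_N -> 'I_N -> R) :
  1 < r -> (0 < N)%N -> (forall S u v, 0 <= p S u v) ->
  (forall S, \sum_(u < N) \sum_(v < N) p S u v = 1) ->
  (forall S u v, u \in S -> v \notin S -> p S u v <= r * p S v u) ->
  N%:R^-1 * \sum_(v < N) fixprob (repl_step p) [set v] <= (1 - r^-1) / (1 - r^-1 ^+ N).
Proof.
move=> r1 N0 p0 p1 pr.
have r0 : 0 < r by lra.
set y := r^-1.
have y0 : 0 < y by rewrite invr_gt0.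
have y1 : y < 1 by rewrite invf_lt1.
have yN : 0 < 1 - y ^+ N by rewrite subr_gt0 exprn_ilt1 // ?ltW // -lt0n.
pose h S : R := (1 - y ^+ #|S|) / (1 - y ^+ N).
have h0 S : 0 <= h S.
  by rewrite divr_ge0 ?(ltW yN) // subr_ge0 exprn_ile1 // ltW.
have hT : 1 <= h [set: 'I_N]%SET by rewrite /h cardsT card_ord divff // gt_eqF.
have hh S : repl_step p h S <= h S.
  rewrite -subr_le0 repl_stepB //; apply: sumr_le0 => u uS; apply: sumr_le0 => v.
  rewrite inE => vS.
  have -> : h (v |: S) - h S = (1 - y) * y ^+ #|S| / (1 - y ^+ N).
    by rewrite /h cardsU1 vS add1n exprS -mulrBl; congr (_ / _); ring.
  have -> : h (S :\ u) - h S = - (1 - y) * y ^+ #|S|.-1 / (1 - y ^+ N).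
    rewrite /h (cardsD1 u S) uS add1n /= exprS -mulrBl; congr (_ / _); ring.
  have -> : y ^+ #|S| = y * y ^+ #|S|.-1 by rewrite -exprS prednK // (cardD1 u) uS.
  have := pr S u v uS vS; rewrite -[_ <= _ * _]subr_ge0 => ge.
  have -> : p S u v * ((1 - y) * (y * y ^+ #|S|.-1) / (1 - y ^+ N)) +
     p S v u * (- (1 - y) * y ^+ #|S|.-1 / (1 - y ^+ N)) =
     - ((r * p S v u - p S u v) * (y * (1 - y) * y ^+ #|S|.-1 / (1 - y ^+ N))).
    have ry : r * y = 1 by rewrite mulfV // gt_eqF.
    by rewrite -[p S v u in LHS]mul1r -ry; ring.
  rewrite oppr_le0 mulr_ge0 // divr_ge0 ?(ltW yN) // mulr_ge0 ?exprn_ge0 ?(ltW y0) //.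
  by rewrite mulr_ge0 ?(ltW y0) // subr_ge0 ltW.
have le v : fixprob (repl_step p) [set v] <= (1 - y) / (1 - y ^+ N).
  by apply: le_trans (fixprob_superharmonic p0 p1 h0 hT hh _) _; rewrite /h cards1 expr1.
rewrite mulrC ler_pdivrMr ?ltr0n //.
by apply: le_trans (ler_sum _ (fun v _ => le v)) _; rewrite sumr_const card_ord mulr_natr.
Qed.

Variables (r : R) (w : 'I_N -> 'I_N -> R).
Hypothesis r_ge1 : 1 <= r.
Hypothesis w_graph : weighted_graph w.
Hypothesis deg_gt0 : forall u, 0 < wdeg w u.

Definition Bd_kernel S u v : R := fit r S u / total_fit r S * (w u v / wdeg w u).

Definition dB_weight S v : R := \sum_(u < N) fit r S u * w u v.

Definition dB_kernel S u v : R := N%:R^-1 * (fit r S u * w u v / dB_weight S v).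

Lemma dB_stepE : dB_step r w = repl_step dB_kernel.
Proof.
apply/funext => g; apply/funext => S; rewrite /repl_step exchange_big.
apply: eq_bigr => v _; rewrite mulr_sumr; apply: eq_bigr => u _.
by rewrite /dB_kernel mulrA.
Qed.

Lemma fit_ge1 S u : 1 <= fit r S u.
Proof. by rewrite /fit; case: ifP. Qed.

Lemma fit_ge0 S u : 0 <= fit r S u.
Proof. exact: le_trans (fit_ge1 S u). Qed.

Lemma fit_le S u : fit r S u <= r.
Proof. by rewrite /fit; case: ifP. Qed.

Lemma total_fit_gt0 S : (0 < N)%N -> 0 < total_fit r S.
Proof.
move=> N0; rewrite (lt_le_trans (_ : 0 < N%:R)) ?ltr0n // /total_fit.
have -> : N%:R = \sum_(u < N) (1 : R) by rewrite sumr_const card_ord.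
by apply: ler_sum => u _; apply: fit_ge1.
Qed.

Lemma dB_weight_ge S v : wdeg w v <= dB_weight S v.
Proof.
have [w0 [ws _]] := w_graph; apply: ler_sum => u _; rewrite ws.
by apply: ler_peMl; rewrite ?fit_ge1.
Qed.

Lemma dB_weight_le S v : dB_weight S v <= r * wdeg w v.
Proof.
have [w0 [ws _]] := w_graph; rewrite /wdeg mulr_sumr; apply: ler_sum => u _.
by rewrite ws; apply: ler_wpM2r; rewrite ?fit_le.
Qed.

Lemma dB_weight_gt0 S v : 0 < dB_weight S v.
Proof. exact: lt_le_trans (deg_gt0 v) (dB_weight_ge S v). Qed.

Lemma Bd_kernel_ge0 S u v : 0 <= Bd_kernel S u v.
Proof.
have [w0 _] := w_graph; have N0 : (0 < N)%N by case: (N) u => [[]|].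
by rewrite !mulr_ge0 // ?invr_ge0 ?fit_ge0 // ltW // total_fit_gt0.
Qed.

Lemma dB_kernel_ge0 S u v : 0 <= dB_kernel S u v.
Proof.
have [w0 _] := w_graph.
by rewrite !mulr_ge0 // ?invr_ge0 ?fit_ge0 // ltW // dB_weight_gt0.
Qed.

Lemma Bd_kernel_sum S : (0 < N)%N -> \sum_(u < N) \sum_(v < N) Bd_kernel S u v = 1.
Proof.
move=> N0; have degV u : \sum_(v < N) w u v / wdeg w u = 1.
  by rewrite -mulr_suml divff // gt_eqF // deg_gt0.
under eq_bigr do rewrite -mulr_sumr degV mulr1.
by rewrite -mulr_suml divff // gt_eqF // total_fit_gt0.
Qed.

Lemma dB_kernel_sum S : (0 < N)%N -> \sum_(u < N) \sum_(v < N) dB_kernel S u v = 1.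
Proof.
move=> N0; have weightV v : \sum_(u < N) fit r S u * w u v / dB_weight S v = 1.
  by rewrite -mulr_suml divff // gt_eqF // dB_weight_gt0.
rewrite exchange_big /=; under eq_bigr do rewrite -mulr_sumr weightV mulr1.
by rewrite sumr_const card_ord -[_ *+ _]mulr_natr mulVf // pnatr_eq0 -lt0n.
Qed.

End Kernels.

Section Complete.
Variables (R : realType) (N : nat) (r : R).
Hypotheses (r_gt1 : 1 < r) (N_gt1 : (1 < N)%N).

Lemma complete_graph : weighted_graph (@complete_w R N).
Proof.
split=> [u v|]; first by rewrite /complete_w; case: ifP.
by split=> [u v|u]; rewrite /complete_w ?eqxx // eq_sym.
Qed.

Lemma complete_wdeg (u : 'I_N) : wdeg (@complete_w R N) u = N%:R - 1.
Proof.
rewrite /wdeg (bigD1 u) //= {1}/complete_w eqxx add0r.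
rewrite (eq_bigr (fun=> 1)) => [|v vu]; last by rewrite /complete_w eq_sym (negbTE vu).
by rewrite sumr_const cardC1 card_ord -subn1 natrB // ltnW.
Qed.

Lemma complete_wdeg_gt0 (u : 'I_N) : 0 < wdeg (@complete_w R N) u.
Proof. by rewrite complete_wdeg subr_gt0 ltr1n. Qed.

Lemma rho_Bd_complete_le :
  rho_Bd r (@complete_w R N) <= (1 - r^-1) / (1 - r^-1 ^+ N).
Proof.
have N0 := ltnW N_gt1; have r1 := ltW r_gt1.
apply: (@geometric_superharmonic _ _ r (Bd_kernel r (@complete_w R N))) => //.
- by move=> S u v; apply: Bd_kernel_ge0 => //; [exact: complete_graph | exact: complete_wdeg_gt0].
- by move=> S; apply: Bd_kernel_sum => //; exact: complete_wdeg_gt0.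
move=> S u v uS vS; rewrite /Bd_kernel /fit uS (negbTE vS) !complete_wdeg /complete_w (eq_sym v).
by rewrite mul1r !mulrA.
Qed.

Lemma complete_dB_weight (S : {set 'I_N}) v :
  dB_weight r (@complete_w R N) S v = total_fit r S - fit r S v.
Proof.
rewrite /dB_weight /total_fit [in RHS](bigD1 v) //= [RHS]addrC addKr (bigD1 v) //=.
rewrite {1}/complete_w eqxx mulr0 add0r; apply: eq_bigr => u uv.
by rewrite /complete_w (negbTE uv) mulr1.
Qed.

Lemma rho_dB_complete_le :
  rho_dB r (@complete_w R N) <= (1 - r^-1) / (1 - r^-1 ^+ N).
Proof.
have N0 := ltnW N_gt1; have r1 := ltW r_gt1.
have gr := complete_graph; have dg := complete_wdeg_gt0.
rewrite /rho_dB dB_stepE; apply: geometric_superharmonic => //.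
- by move=> S u v; apply: dB_kernel_ge0.
- by move=> S; apply: dB_kernel_sum.
move=> S u v uS vS; rewrite /dB_kernel /fit uS (negbTE vS).
rewrite [leRHS]mulrCA ler_pM2l ?invr_gt0 ?ltr0n // mul1r -mulrA.
rewrite ler_pM2l ?(lt_trans ltr01) // (gr.2.1 v u); apply: ler_wpM2l; first exact: gr.1.
rewrite lef_pV2 ?posrE ?dB_weight_gt0 //.
by rewrite !complete_dB_weight /fit uS (negbTE vS) lerD2l lerN2.
Qed.

End Complete.

(** * Product potentials on islands *)

Lemma sum_le_cst (R : realDomainType) n (P : pred 'I_n) (F : 'I_n -> R) (c : R) :
  0 <= c -> (forall i, P i -> F i <= c) -> \sum_(i < n | P i) F i <= n%:R * c.
Proof.
move=> c0 Fc; apply: le_trans (ler_sum _ Fc) _; rewrite sumr_const -[leLHS]mulr_natl.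
by rewrite ler_wpM2r // ler_nat -[leqRHS]card_ord max_card.
Qed.

Section Islands.
Variables (R : realType) (N : nat) (I : finType) (isl : 'I_N -> I) (hub : pred I).
Variables (g : I -> nat -> R) (rv : I -> R).
Implicit Types (S : {set 'I_N}) (u v : 'I_N) (i : I).

Definition island i : {set 'I_N} := [set u | isl u == i].

Definition island_potential S : R := \prod_(i : I) g i #|island i :&: S|.

(* Relative decrease (increase) of the potential when the island [i], holding [j]
   mutants, gains (loses) a mutant, in units of the reproductive value [rv i]. *)
Definition gain i j : R := (g i j - g i j.+1) / (rv i * g i j).
Definition loss i j : R := (g i j.-1 - g i j) / (rv i * g i j).

Hypothesis rv_gt0 : forall i, 0 < rv i.
Hypothesis g_gt0 : forall i j, (j <= #|island i|)%N -> 0 < g i j.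

Lemma island_potential_gt0 S : 0 < island_potential S.
Proof. by apply: prodr_gt0 => i _; rewrite g_gt0 // subset_leq_card // subsetIl. Qed.

Lemma island_potentialU1 S v : v \notin S ->
  island_potential (v |: S) - island_potential S =
  - (island_potential S * rv (isl v) * gain (isl v) #|island (isl v) :&: S|).
Proof.
move=> vS; set i := isl v; have gS i' : 0 < g i' #|island i' :&: S|.
  by rewrite g_gt0 // subset_leq_card // subsetIl.
rewrite /island_potential (bigD1 i) //= [X in _ - X](bigD1 i) //= [in RHS](bigD1 i) //=.
have -> : #|island i :&: (v |: S)| = #|island i :&: S|.+1.
  rewrite (_ : _ :&: _ = v |: (island i :&: S)); last first.
    by apply/setP => x; rewrite !inE; case: (x =P v) => [->|]; rewrite ?eqxx.
  by rewrite cardsU1 !inE (negbTE vS) andbF.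
rewrite (eq_bigr (fun i' => g i' #|island i' :&: S|)) => [|i' i'i]; last first.
  congr (g _ #|pred_of_set _|); apply/setP => x; rewrite !inE.
  by case: (x =P v) => [->|]; rewrite // [isl v == _]eq_sym (negbTE i'i).
rewrite /gain; have := gS i; have := rv_gt0 i; set P := \prod_(_ | _) _ => r0 g0.
by field; rewrite !gt_eqF.
Qed.

Lemma island_potentialD1 S u : u \in S ->
  island_potential (S :\ u) - island_potential S =
  island_potential S * rv (isl u) * loss (isl u) #|island (isl u) :&: S|.
Proof.
move=> uS; set i := isl u; have gS i' : 0 < g i' #|island i' :&: S|.
  by rewrite g_gt0 // subset_leq_card // subsetIl.
rewrite /island_potential (bigD1 i) //= [X in _ - X](bigD1 i) //= [in RHS](bigD1 i) //=.
have -> : #|island i :&: (S :\ u)| = #|island i :&: S|.-1.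
  rewrite [in RHS](cardsD1 u) !inE uS eqxx add1n /=.
  by congr #|pred_of_set _|; apply/setP => x; rewrite !inE andbCA.
rewrite (eq_bigr (fun i' => g i' #|island i' :&: S|)) => [|i' i'i]; last first.
  congr (g _ #|pred_of_set _|); apply/setP => x; rewrite !inE.
  by case: (x =P u) => [->|]; rewrite // [isl u == _]eq_sym (negbTE i'i).
rewrite /loss; have := gS i; have := rv_gt0 i; set P := \prod_(_ | _) _ => r0 g0.
by field; rewrite !gt_eqF.
Qed.

(* Both processes have transition probabilities of the form [pE]: for Bd,
   [W u v = w u v / (deg u * deg v)] and [kappa = 1]; for dB, [W = w] and [kappa S v]
   is [deg v] over the fitness-weighted degree of [v]. *)
Variables (r theta C E omega W0 : R).
Variables (p : {set 'I_N} -> 'I_N -> 'I_N -> R).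
Variables (Z : {set 'I_N} -> R) (W : 'I_N -> 'I_N -> R) (kappa : {set 'I_N} -> 'I_N -> R).

Let slack i : R := 1 + (r - 1) / (#|island i|%:R - 1).

Hypothesis r_ge1 : 1 <= r.
Hypothesis C_ge0 : 0 <= C.
Hypothesis E_ge0 : 0 <= E.
Hypothesis omega_ge0 : 0 <= omega.
Hypothesis p_ge0 : forall S u v, 0 <= p S u v.
Hypothesis p_sum1 : forall S, \sum_(u < N) \sum_(v < N) p S u v = 1.
Hypothesis gain_ge0 : forall i j, (j < #|island i|)%N -> 0 <= gain i j.
Hypothesis loss_ge0 : forall i j, (0 < j <= #|island i|)%N -> 0 <= loss i j.
Hypothesis loss_gain_cross : forall i i' j j',
  (j < #|island i|)%N -> (0 < j' <= #|island i'|)%N -> loss i' j' - gain i j <= C.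
Hypothesis loss_gain_internal : forall i j, (0 < j < #|island i|)%N ->
  slack i * loss i j - r * gain i j <= - (r * E).
Hypothesis loss_gain_homogeneous : forall i i', hub i (+) hub i' ->
  loss i' #|island i'| <= r * theta * gain i 0.
Hypothesis pE : forall S u v, p S u v = Z S * (fit r S u * W u v * kappa S v / rv (isl v)).
Hypothesis Z_ge0 : forall S, 0 <= Z S.
Hypothesis W_ge0 : forall u v, 0 <= W u v.
Hypothesis W_sym : forall u v, W u v = W v u.
Hypothesis W_cross : forall u v, isl u != isl v -> W u v <= omega.
Hypothesis W_hub : forall u v, isl u != isl v -> ~~ (hub (isl u) (+) hub (isl v)) -> W u v = 0.
Hypothesis W_internal : forall u v, u != v -> isl u = isl v -> W0 <= W u v.
Hypothesis W0_ge0 : 0 <= W0.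
Hypothesis kappa_ge : forall S v, r^-1 <= kappa S v.
Hypothesis kappa_le1 : forall S v, kappa S v <= 1.
Hypothesis kappa_internal : forall S u v, isl u = isl v -> u \in S -> v \notin S ->
  kappa S u <= slack (isl v) * kappa S v.
Hypothesis kappa_homogeneous : forall S v, island (isl v) :&: S = finset.set0 ->
  theta <= kappa S v.
Hypothesis cross_small : (N%:R + N%:R ^+ 2) * (omega * C) <= W0 * E.

Let T S u v : R := W u v *
  (kappa S u * loss (isl u) #|island (isl u) :&: S|
   - r * kappa S v * gain (isl v) #|island (isl v) :&: S|).

Let r_gt0 : 0 < r. Proof. exact: lt_le_trans r_ge1. Qed.

Let kappa_ge0 S v : 0 <= kappa S v.
Proof. by apply: le_trans (kappa_ge S v); rewrite invr_ge0 ltW. Qed.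

Lemma island_potential_term S u v : u \in S -> v \notin S ->
  p S u v * (island_potential (v |: S) - island_potential S) +
  p S v u * (island_potential (S :\ u) - island_potential S) =
  island_potential S * Z S * T S u v.
Proof.
move=> uS vS; rewrite island_potentialU1 // island_potentialD1 // !pE /fit uS (negbTE vS).
rewrite /T (W_sym v u); have := rv_gt0 (isl u); have := rv_gt0 (isl v) => rv0 ru0.
by field; rewrite !gt_eqF.
Qed.

Let card_in S u : u \in S -> (0 < #|island (isl u) :&: S| <= #|island (isl u)|)%N.
Proof.
move=> uS; rewrite subset_leq_card ?subsetIl // andbT card_gt0.
by apply/set0Pn; exists u; rewrite !inE eqxx.
Qed.

Let card_notin S v : v \notin S -> (#|island (isl v) :&: S| < #|island (isl v)|)%N.
Proof.
move=> vS; apply: proper_card; rewrite properE subsetIl /=.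
by apply/subsetPn; exists v; rewrite !inE ?eqxx //= (negbTE vS).
Qed.

Lemma cross_term_le S u v : u \in S -> v \notin S -> isl u != isl v -> T S u v <= omega * C.
Proof.
move=> uS vS uv; rewrite /T; apply: le_trans (_ : W u v * C <= _); last first.
  exact: ler_wpM2r (W_cross uv).
apply: ler_wpM2l => //; apply: le_trans (loss_gain_cross (card_notin vS) (card_in uS)).
apply: lerB; first exact: ler_piMl (loss_ge0 (card_in uS)) (kappa_le1 _ _).
apply: ler_peMl; first exact: gain_ge0 (card_notin vS).
by rewrite -ler_pdivrMl // mulr1.
Qed.

Lemma internal_term_le S u v : u \in S -> v \notin S -> isl u = isl v -> T S u v <= - (W0 * E).
Proof.
move=> uS vS uv.
have uNv : u != v by apply: contraNneq vS => <-.
have Wuv := W_internal uNv uv.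
rewrite /T uv; set j := #|_ :&: S|.
have jI : (0 < j < #|island (isl v)|)%N.
  by rewrite card_notin // andbT; have /andP[] := card_in uS; rewrite uv.
have l0 : 0 <= loss (isl v) j by apply: loss_ge0; case/andP: jI => -> /ltnW ->.
have : kappa S u * loss (isl v) j - r * kappa S v * gain (isl v) j <= - E.
  apply: le_trans (_ : kappa S v * (slack (isl v) * loss (isl v) j - r * gain (isl v) j) <= _).
    have := ler_wpM2r l0 (kappa_internal uv uS vS).
    move: (loss _ _) (gain _ _) (slack _) => lo ga sl; lra.
  apply: le_trans (ler_wpM2l (kappa_ge0 S v) (loss_gain_internal jI)) _.
  rewrite mulrN lerN2 mulrA ler_peMl // -ler_pdivrMr // mul1r; exact: kappa_ge.
move=> le; apply: le_trans (ler_wpM2l (W_ge0 u v) le) _.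
by rewrite mulrN lerN2 ler_wpM2r.
Qed.

Lemma homogeneous_term_le0 S u v : u \in S -> v \notin S -> isl u != isl v ->
  island (isl u) :&: S = island (isl u) -> island (isl v) :&: S = finset.set0 ->
  T S u v <= 0.
Proof.
move=> uS vS uv Su Sv; have [xor|nxor] := boolP (hub (isl v) (+) hub (isl u)); last first.
  by rewrite /T W_hub ?mul0r // addbC.
rewrite /T Su Sv cards0 mulr_ge0_le0 // subr_le0.
apply: le_trans (_ : loss (isl u) #|island (isl u)| <= _).
  by apply: ler_piMl => //; have := card_in uS; rewrite Su; apply: loss_ge0.
apply: le_trans (loss_gain_homogeneous xor) _.
rewrite -!mulrA ler_pM2l //; apply: ler_wpM2r; last exact: kappa_homogeneous.
by apply: gain_ge0; have := card_notin vS; rewrite Sv cards0.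
Qed.

Lemma island_potential_superharmonic S :
  repl_step p island_potential S <= island_potential S.
Proof.
rewrite -subr_le0 repl_stepB //.
have -> : \sum_(u in S) \sum_(v in ~: S)
    (p S u v * (island_potential (v |: S) - island_potential S) +
     p S v u * (island_potential (S :\ u) - island_potential S)) =
   island_potential S * Z S * \sum_(u in S) \sum_(v in ~: S) T S u v.
  rewrite mulr_sumr; apply: eq_bigr => u uS; rewrite mulr_sumr; apply: eq_bigr => v.
  by rewrite inE => vS; apply: island_potential_term.
apply: mulr_ge0_le0; first by rewrite mulr_ge0 // ltW // island_potential_gt0.
have [/existsP[u0 /existsP[v0 /and3P[u0S v0S /eqP uv0]]]|homo] :=
    boolP [exists u, exists v, [&& u \in S, v \notin S & isl u == isl v]].
  have T_le u v : u \in S -> v \in ~: S -> T S u v <= omega * C.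
    rewrite inE => uS vS; have [uv|uv] := eqVneq (isl u) (isl v).
      apply: le_trans (internal_term_le uS vS uv) _.
      by rewrite (@le_trans _ _ 0) ?oppr_le0 ?mulr_ge0.
    exact: cross_term_le.
  rewrite (bigD1 u0) //= (bigD1 v0) ?inE //=.
  have oC : 0 <= omega * C by rewrite mulr_ge0.
  have row u : u \in S -> \sum_(v in ~: S) T S u v <= N%:R * (omega * C).
    by move=> uS; apply: sum_le_cst => // v; apply: T_le.
  have row0 : \sum_(v in ~: S | v != v0) T S u0 v <= N%:R * (omega * C).
    by apply: sum_le_cst => // v /andP[vS _]; apply: T_le.
  have rest : \sum_(u in S | u != u0) \sum_(v in ~: S) T S u v
      <= N%:R * (N%:R * (omega * C)).
    by apply: sum_le_cst => [|u /andP[uS _]]; [rewrite mulr_ge0 | exact: row].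
  have := internal_term_le u0S v0S uv0; have := cross_small; lra.
apply: sumr_le0 => u uS; apply: sumr_le0 => v; rewrite inE => vS.
move: homo; rewrite negb_exists => /forallP nex.
have homo x y : x \in S -> y \notin S -> isl x != isl y.
  by move=> xS yS; have /existsPn/(_ y) := nex x; rewrite xS yS.
apply: homogeneous_term_le0 => //; first exact: homo.
  apply/finset.setIidPl/fintype.subsetP => x; rewrite inE => xu; apply: contraLR uS => xS.
  by apply: contraL xu => uS; rewrite eq_sym homo.
apply/setP => x; rewrite !inE; apply/negP => /andP[xv xS].
by have := homo x v xS vS; rewrite xv.
Qed.

End Islands.

(** * The potential of one island *)

Section Profile.
Variables (R : realType) (n m : nat) (main : pred 'I_n) (s L : R).
Hypotheses (s_gt0 : 0 < s) (s_lt : s < 1 / 5) (m_gt100 : (100 < m)%N) (m_le102 : (m <= 102)%N).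
Hypothesis L_ge : 100 * 100 * 100 <= L.

Let sigma : R := 40 * s.

(* The concave correction [1 - s / 4] makes the drift inside a mixed pair strictly
   negative even for dB, under which a pair is internally neutral. *)
Definition pair_profile (c : R) (j : nat) : R :=
  match j with 0 => 1 | 1 => 1 - c / 2 * (1 - s / 4) | _ => 1 - c end.

(* The increments of the hub profile shrink by a factor at most [1 + s / 2] per step,
   less than selection inside the hub allows, but by [1 + (m - 1) * s / 2 > 1 + 40 * s]
   from the first to the last mutant: this is the amplification. *)
Definition hub_sum (j : nat) : R := \sum_(l < j) (1 + l%:R * s / 2)^-1.

Definition profile (i : option 'I_n) (j : nat) : R :=
  match i with
  | None => 1 - sigma / (2 * L) * hub_sum j
  | Some k => pair_profile (if main k then sigma / (1 + sigma) else sigma / L ^+ 2) j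
  end.

(* Reproductive values, normalised so that a main pair has total value [1]. *)
Definition repro (i : option 'I_n) : R :=
  match i with
  | None => (2 * L)^-1
  | Some k => if main k then 2^-1 else (2 * L ^+ 2)^-1
  end.

Definition island_size (i : option 'I_n) : nat := if i is None then m else 2.

Let L_gt0 : 0 < L. Proof. by have := L_ge; lra. Qed.

Let L2_ge : 100 * 100 * 100 <= L ^+ 2.
Proof. by have := L_ge; nra. Qed.

Lemma repro_gt0 i : 0 < repro i.
Proof.
by case: i => [k|] /=; rewrite ?invr_gt0 ?mulr_gt0 //; case: ifP => _; rewrite invr_gt0 ?mulr_gt0 ?exprn_gt0.
Qed.

Lemma hub_sum_ge0 j : 0 <= hub_sum j.
Proof.
apply: sumr_ge0 => l _; rewrite invr_ge0 addr_ge0 // !mulr_ge0 // ?ler0n ?invr_ge0 //.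
exact: ltW.
Qed.

Lemma hub_sum_le j : hub_sum j <= j%:R.
Proof.
have -> : j%:R = \sum_(l < j) (1 : R) by rewrite sumr_const card_ord.
apply: ler_sum => l _; have l0 : 0 <= l%:R * s / 2 by rewrite !mulr_ge0 ?ler0n ?invr_ge0 ?(ltW s_gt0).
by rewrite invf_le1; lra.
Qed.

Lemma hub_profile_bounds j : (j <= m)%N ->
  1 - s / 100 <= profile None j <= 1.
Proof.
move=> jm; have h0 := hub_sum_ge0 j; have := hub_sum_le j.
have : (j%:R : R) <= 102%:R by rewrite ler_nat (leq_trans jm).
move=> j102 hj; rewrite /= /sigma; have h102 : hub_sum j <= 102 by lra.
have -> : 40 * s / (2 * L) * hub_sum j = 20 * (s * hub_sum j) / L.
  by field; rewrite gt_eqF.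
have sh : 0 <= s * hub_sum j by rewrite mulr_ge0 // ltW.
have sh2 : s * hub_sum j <= s * 102 by rewrite ler_pM2l.
apply/andP; split; last first.
  by rewrite lerBlDr lerDl divr_ge0 ?(ltW L_gt0) //; lra.
rewrite lerB // ler_pdivrMr //; have := L_ge; nra.
Qed.

Lemma pair_bounds k : exists c e : R,
  [/\ profile (Some k) =1 pair_profile c,
      c / (2 * repro (Some k)) = e,
      0 <= c, c < 1 & [/\ sigma / (1 + sigma) <= e, e <= sigma & e * (1 + s / 4) / (1 - c) <= sigma * (1 + s / 2)] ].
Proof.
have s0 := s_gt0; have s1 := s_lt; have L2 := L2_ge; have s40 : 0 < 1 + sigma by rewrite /sigma; lra.
exists (if main k then sigma / (1 + sigma) else sigma / L ^+ 2).
exists (if main k then sigma / (1 + sigma) else sigma).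
rewrite /=; case mk: (main k).
  have q1 : sigma / (1 + sigma) < 1 by rewrite ltr_pdivrMr //; lra.
  split => //.
  - by move=> j /=; rewrite mk.
  - by field; rewrite /sigma; rewrite gt_eqF.
  - by rewrite divr_ge0 // /sigma; lra.
  split => //.
    by rewrite ler_pdivrMr // /sigma; nra.
  have -> : sigma / (1 + sigma) * (1 + s / 4) / (1 - sigma / (1 + sigma)) = sigma * (1 + s / 4).
    by field; rewrite !gt_eqF // /sigma; lra.
  by rewrite /sigma; nra.
have L20 : 0 < L ^+ 2 by lra.
have cs : sigma / L ^+ 2 <= s / 100 by rewrite ler_pdivrMr // /sigma; nra.
split => //.
- by move=> j /=; rewrite mk.
- by field; rewrite gt_eqF.
- by rewrite divr_ge0 // ?ltW // /sigma; lra.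
- by lra.
have ss : 0 <= s * s by rewrite mulr_ge0 // ltW.
split => //; first by rewrite ler_pdivrMr // /sigma; lra.
move: cs; set c := sigma / L ^+ 2 => cs; rewrite ler_pdivrMr; last by lra.
rewrite /sigma -!mulrA.
rewrite ler_pM2l // ler_pM2l //.
have : 0 <= s * (s / 100 - c) by rewrite mulr_ge0 ?(ltW s0) //; lra.
have : s * s <= s / 5 by nra.
lra.
Qed.

Local Notation pgain := (gain profile repro).
Local Notation ploss := (loss profile repro).

Lemma profile_gt0 i j : (j <= island_size i)%N -> 0 < profile i j.
Proof.
case: i => [k|] /= jm; last by have /andP[/= ? _] := hub_profile_bounds jm; have := s_lt; lra.
have [c [e [gE _ c0 c1 _]]] := pair_bounds k; have := gE j; rewrite /= => ->.
have s0 := s_gt0; have s1 := s_lt; case: j jm => [|[|j]] _ /=; nra.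
Qed.

Let hub_den_ge1 j : 1 <= 1 + j%:R * s / 2.
Proof. by rewrite lerDl !mulr_ge0 ?ler0n ?invr_ge0 ?(ltW s_gt0). Qed.

Let hub_den_le j : (j <= m)%N -> 1 + j%:R * s / 2 <= 1 + 51 * s.
Proof.
move=> jm; have : (j%:R : R) <= 102%:R by rewrite ler_nat (leq_trans jm).
by move=> j102; have := s_gt0; nra.
Qed.

Lemma hub_gainE j : (j <= m)%N ->
  pgain None j = sigma / ((1 + j%:R * s / 2) * profile None j).
Proof.
move=> jm; have g0 := profile_gt0 (i := None) jm; have d0 := hub_den_ge1 j.
rewrite /gain (_ : profile None j - _ = sigma / (2 * L) / (1 + j%:R * s / 2)); last first.
  by rewrite /= /hub_sum big_ord_recr /=; ring.
move: (profile _ _) g0 => G g0; rewrite /=.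
by field; rewrite !gt_eqF //; have := d0; lra.
Qed.

Lemma hub_lossE j : (j < m)%N ->
  ploss None j.+1 = sigma / ((1 + j%:R * s / 2) * profile None j.+1).
Proof.
move=> jm; have g0 := profile_gt0 (i := None) jm; have d0 := hub_den_ge1 j.
rewrite /loss (_ : profile None _ - _ = sigma / (2 * L) / (1 + j%:R * s / 2)); last first.
  by rewrite /= /hub_sum big_ord_recr /=; ring.
move: (profile _ _) g0 => G g0; rewrite /=.
by field; rewrite !gt_eqF //; have := d0; lra.
Qed.

Lemma pair_gain_loss k : exists c e : R,
  [/\ pgain (Some k) 0 = e * (1 - s / 4),
      pgain (Some k) 1 = e * (1 + s / 4) / (1 - c / 2 * (1 - s / 4)),
      ploss (Some k) 1 = e * (1 - s / 4) / (1 - c / 2 * (1 - s / 4)),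
      ploss (Some k) 2 = e * (1 + s / 4) / (1 - c) &
  [/\ 0 <= c, c < 1, sigma / (1 + sigma) <= e, e <= sigma &
      e * (1 + s / 4) / (1 - c) <= sigma * (1 + s / 2)]].
Proof.
have [c [e [gE eE c0 c1 [e0 e1 e2]]]] := pair_bounds k; exists c, e.
have rv0 := repro_gt0 (Some k); have s0 := s_gt0; have s1 := s_lt.
have g1 : 0 < 1 - c / 2 * (1 - s / 4) by nra.
have rvn := gt_eqF rv0; split; last by split.
all: rewrite /gain /loss !gE -eE; move: (repro _) rvn => rv rvn /=.
all: field; rewrite ?rvn ?andbT //=; rewrite !gt_eqF //; lra.
Qed.

Let den_ge (c : R) : 0 <= c -> c < 1 -> 1 - c <= 1 - c / 2 * (1 - s / 4) <= 1.
Proof. by have s0 := s_gt0; have s1 := s_lt => c0 c1; apply/andP; split; nra. Qed.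

Let frac_ge : sigma * (1 - 40 * s) <= sigma / (1 + sigma).
Proof.
have s0 := s_gt0; rewrite ler_pdivlMr /sigma; last by lra.
have : 0 < s * s * s by rewrite !mulr_gt0.
lra.
Qed.

Lemma gain_lower i j : (j < island_size i)%N ->
  0 <= pgain i j /\ sigma * (1 - 60 * s) <= pgain i j.
Proof.
have s0 := s_gt0; have s1 := s_lt; have sg0 : 0 < sigma by rewrite /sigma; lra.
case: i => [k|] jm; last first.
  have /andP[G1 G2] := hub_profile_bounds (ltnW jm); rewrite (hub_gainE (ltnW jm)).
  have d1 := hub_den_ge1 j; have d2 := hub_den_le (ltnW jm).
  set G := profile _ _ in G1 G2 *; set d := 1 + _ in d1 d2 *.
  have dG : 0 < d * G by rewrite mulr_gt0 //; lra.
  split; first by apply: divr_ge0; apply: ltW.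
  rewrite ler_pdivlMr // -mulrA -[leRHS]mulr1 ler_pM2l //.
  have dG2 : d * G <= 1 + 51 * s by nra.
  have [s60|s60] := lerP (1 - 60 * s) 0; first by rewrite (le_trans _ ler01) // mulr_le0_ge0 // ltW.
  by apply: le_trans (ler_wpM2l (ltW s60) dG2) _; nra.
have [c [e [ga0 ga1 _ _ [c0 c1 e0 e1 _]]]] := pair_gain_loss k.
have /andP[g1 g2] := den_ge c0 c1; have fr := frac_ge.
have fr0 : 0 < sigma / (1 + sigma) by rewrite divr_gt0 //; lra.
have lo : sigma * (1 - 60 * s) <= e * (1 - s / 4).
  by apply: le_trans (_ : sigma / (1 + sigma) * (1 - s / 4) <= _); [rewrite /sigma in fr *; nra | rewrite ler_wpM2r //; lra].
have lo0 : 0 <= e * (1 - s / 4) by nra.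
case: j jm => [|[|//]] _; first by rewrite ga0.
set G := 1 - c / 2 * (1 - s / 4) in ga1 g1 g2.
suff le : e * (1 - s / 4) <= pgain (Some k) 1 by split; apply: le_trans le.
by rewrite ga1 ler_pdivlMr; nra.
Qed.

Lemma loss_upper i j : (0 < j <= island_size i)%N ->
  0 <= ploss i j /\ ploss i j <= sigma * (1 + s).
Proof.
have s0 := s_gt0; have s1 := s_lt; have sg0 : 0 < sigma by rewrite /sigma; lra.
case: i j => [k|] [|j] //= jm; last first.
  have /andP[G1 G2] := hub_profile_bounds jm; rewrite hub_lossE //.
  have d1 := hub_den_ge1 j.
  set G := profile _ _ in G1 G2 *; set d := 1 + _ in d1 *.
  have dG : 0 < d * G by rewrite mulr_gt0 //; lra.
  split; first by apply: divr_ge0; apply: ltW.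
  rewrite ler_pdivrMr // -mulrA ler_peMr ?(ltW sg0) //.
  have dG2 : 1 - s / 100 <= d * G by nra.
  nra.
have [c [e [_ _ lo1 lo2 [c0 c1 e0 e1 e2]]]] := pair_gain_loss k.
have /andP[g1 g2] := den_ge c0 c1.
have fr0 : 0 < sigma / (1 + sigma) by rewrite divr_gt0 //; lra.
have c10 : 0 < 1 - c by lra.
have up : sigma * (1 + s / 2) <= sigma * (1 + s) by rewrite ler_pM2l //; lra.
case: j jm => [|[|//]] _; last first.
  by rewrite lo2; split; [rewrite divr_ge0 //; nra | lra].
rewrite lo1; split; first by rewrite divr_ge0 //; nra.
apply: le_trans up; apply: le_trans e2.
apply: ler_pM => //; [nra | by rewrite invr_ge0; lra | nra |].
by rewrite lef_pV2 ?posrE //; lra.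
Qed.

Lemma internal_decrease i j : (0 < j < island_size i)%N ->
  (1 + s / ((island_size i)%:R - 1)) * ploss i j - (1 + s) * pgain i j
    <= - ((1 + s) * (sigma * s / 30)).
Proof.
have s0 := s_gt0; have s1 := s_lt; have sg0 : 0 < sigma by rewrite /sigma; lra.
case: i j => [k|] [|j] //= jm; last first.
  have /andP[G1 G2] := hub_profile_bounds (ltnW jm).
  rewrite (hub_lossE (ltnW jm)) (hub_gainE (ltnW jm)).
  have dS : 1 + j.+1%:R * s / 2 = 1 + j%:R * s / 2 + s / 2 by rewrite -natr1; ring.
  have d1 := hub_den_ge1 j; have := hub_den_le (ltnW jm); rewrite dS => d2.
  set G := profile _ _ in G1 G2 *; set d := 1 + j%:R * s / 2 in d1 d2 *.
  have G0 : 0 < G by lra.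
  have sl : s / (m%:R - 1) <= s / 100.
    rewrite ler_pM2l // lef_pV2 ?posrE //; have : (101%:R : R) <= m%:R by rewrite ler_nat.
      by lra.
    by lra.
  have X : (1 + s / 100) / d - (1 + s) / (d + s / 2) <= - (s / 25).
    have -> : (1 + s / 100) / d - (1 + s) / (d + s / 2) =
      ((1 + s / 100) * (d + s / 2) - (1 + s) * d) / (d * (d + s / 2)).
      by field; rewrite !gt_eqF //; lra.
    rewrite ler_pdivrMr; last by rewrite mulr_gt0; lra.
    suff : s / 25 * (d * (d + s / 2)) <= (99 / 100) * s * d - s / 2 - s * s / 200 by lra.
    have dd : d * (d + s / 2) <= d * (1 + 51 * s) by rewrite ler_wpM2l //; lra.
    have dd2 : d * (1 + 51 * s) <= d * (56 / 5) by rewrite ler_wpM2l //; lra.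
    nra.
  have Y : (1 + s / (m%:R - 1)) * (sigma / (d * G)) - (1 + s) * (sigma / ((d + s / 2) * G)) <=
     sigma / G * ((1 + s / 100) / d - (1 + s) / (d + s / 2)).
    rewrite (_ : sigma / G * _ = (1 + s / 100) * (sigma / (d * G)) - (1 + s) * (sigma / ((d + s / 2) * G))); last first.
      by field; rewrite !gt_eqF //; lra.
    rewrite lerD2r ler_wpM2r ?lerD2l // divr_ge0 ?(ltW sg0) // mulr_ge0 //; lra.
  apply: le_trans Y _; apply: le_trans (ler_wpM2l _ X) _; first by apply: divr_ge0; apply: ltW.
  rewrite mulrN lerN2; have ss0 : 0 <= sigma * s by rewrite mulr_ge0 ?ltW.
  have Gi : sigma * s * 1 <= sigma * s * G^-1 by apply: ler_wpM2l => //; rewrite invf_ge1.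
  have s5 : s * (sigma * s) <= 1 / 5 * (sigma * s) by apply: ler_wpM2r => //; exact: ltW.
  move: (sigma) (G^-1) Gi s5 => sg Gv Gi s5; lra.
have [c [e [_ ga1 lo1 _ [c0 c1 e0 e1 _]]]] := pair_gain_loss k.
case: j jm => [|//] _; rewrite ga1 lo1.
have /andP[] := den_ge c0 c1; set G := 1 - c / 2 * (1 - s / 4) => g1 g2.
have e9 : sigma / 9 <= e.
  apply: le_trans e0; rewrite ler_pM2l // lef_pV2 ?posrE /sigma; lra.
have -> : (1 + s / (2%:R - 1)) = 1 + s by rewrite (_ : 2%:R - 1 = 1) ?divr1 //; ring.
have AB : e * (1 - s / 4) / G - e * (1 + s / 4) / G <= - (sigma * s / 30).
  rewrite -mulrBl ler_pdivrMr; last by lra.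
  have : G * (sigma * s / 30) <= 1 * (sigma * s / 30).
    by rewrite ler_wpM2r // divr_ge0 // mulr_ge0 // ltW.
  have : s * (sigma / 9) <= s * e by rewrite ler_pM2l.
  move: (sigma) sg0 => sg sg0 h1 h2; have := mulr_gt0 s0 sg0; lra.
have s1' : 0 <= 1 + s by lra.
have := ler_wpM2l s1' AB; move: (_ / G) (_ / G) => A B; lra.
Qed.

Lemma homogeneous_decrease i i' : (i == None) (+) (i' == None) ->
  ploss i' (island_size i') <= (1 + s) * (1 + s / 4)^-1 * pgain i 0.
Proof.
have s0 := s_gt0; have s1 := s_lt; have sg0 : 0 < sigma by rewrite /sigma; lra.
case: i i' => [k|] [k'|] //= _.
  have [c [e [ga0 _ _ _ [c0 c1 e0 e1 _]]]] := pair_gain_loss k.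
  have m0 : (0 < m)%N by apply: leq_trans m_gt100.
  have := @hub_lossE m.-1; rewrite prednK // => -> //.
  have /andP[G1 G2] := hub_profile_bounds (leqnn m).
  have d1 : 1 + 50 * s <= 1 + m.-1%:R * s / 2.
    have : (100%:R : R) <= m.-1%:R by rewrite ler_nat -ltnS prednK.
    nra.
  set G := profile _ _ in G1 G2 *; set d := 1 + m.-1%:R * s / 2 in d1 *.
  apply: le_trans (_ : sigma / (1 + sigma) <= _).
    rewrite ler_pM2l // lef_pV2 ?posrE /sigma; first nra; first by rewrite mulr_gt0; lra.
    by lra.
  have e00 : 0 <= e by apply: le_trans e0; apply: divr_ge0; lra.
  rewrite ga0; apply: le_trans e0 _; rewrite mulrCA ler_peMr //.
  rewrite mulrAC ler_pdivlMr; nra.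
have [c [e [_ _ _ lo2 [_ _ _ _ e2]]]] := pair_gain_loss k'.
rewrite lo2; apply: le_trans e2 _; rewrite hub_gainE //.
have -> : profile None 0 = 1 by rewrite /= /hub_sum big_ord0 mulr0 subr0.
rewrite !mul0r addr0 !mulr1 divr1 mulrC ler_pM2r // ler_pdivlMr; nra.
Qed.

End Profile.

(** * Comparison with the complete graph *)

Section Comparison.
Variables (R : realType) (N n : nat) (s P : R).
Hypotheses (s_gt0 : 0 < s) (s_lt : s < 1 / 5) (N_ge : (40 * 100 <= N)%N).
Hypothesis n_ge : (24 * N <= 100 * n)%N.
Hypotheses (P_ge0 : 0 <= P) (P_le : P <= 1 / 200).

Let y : R := (1 + s)^-1.
Let q : R := (1 + 40 * s)^-1.

Lemma bernoulli_ineq (x : R) k : 0 <= x -> 1 + k%:R * x <= (1 + x) ^+ k.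
Proof.
move=> x0; elim: k => [|k IH]; first by rewrite mul0r addr0 expr0.
rewrite exprSr -natr1; have k0 : 0 <= k%:R :> R by rewrite ler0n.
have h : 0 <= 1 + x by lra.
apply: le_trans (ler_wpM2r h IH); have : 0 <= k%:R * x * x by rewrite !mulr_ge0.
lra.
Qed.

Lemma bernoulli_sub_ineq (x : R) k : 0 <= x <= 1 -> 1 - k%:R * x <= (1 - x) ^+ k.
Proof.
move=> /andP[x0 x1]; elim: k => [|k IH]; first by rewrite mul0r subr0 expr0.
rewrite exprSr -natr1; have k0 : 0 <= k%:R :> R by rewrite ler0n.
have h : 0 <= 1 - x by lra.
apply: le_trans (ler_wpM2r h IH); have : 0 <= k%:R * x * x by rewrite !mulr_ge0.
lra.
Qed.

Lemma sum_natr k : \sum_(i < k) (i%:R : R) = k%:R * (k%:R - 1) / 2.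
Proof.
elim: k => [|k IH]; first by rewrite big_ord0 !mul0r.
by rewrite big_ord_recr /= IH -natr1; field.
Qed.

Let N0 : 40 * 100 <= N%:R :> R. Proof. by rewrite -natrM ler_nat. Qed.
Let nN : 24 * N%:R <= 100 * n%:R :> R. Proof. by rewrite -!natrM ler_nat. Qed.
Let y01 : 0 < y < 1. Proof. by rewrite invr_gt0 invf_lt1; have := s_gt0; lra. Qed.
Let q01 : 0 < q < 1. Proof. by rewrite invr_gt0 invf_lt1; have := s_gt0; lra. Qed.
Let yN1 : 0 < 1 - y ^+ N.
Proof.
case/andP: y01 => y0 y1; rewrite subr_gt0 exprn_ilt1 ?ltW //.
by rewrite -lt0n (leq_trans _ N_ge).
Qed.

Lemma complete_bound_large : (1 - y) / (1 - y ^+ N) * N%:R <= (1 + N%:R * s) / (1 + s).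
Proof.
have s0 := s_gt0; have := N0 => N1.
have X0 : 0 < N%:R * s by rewrite mulr_gt0 //; lra.
have yN : y ^+ N <= (1 + N%:R * s)^-1.
  rewrite /y exprVn lef_pV2 ?posrE ?bernoulli_ineq ?(ltW s0) //; last by lra.
  by rewrite exprn_gt0; lra.
have -> : 1 - y = s / (1 + s) by rewrite /y; field; rewrite gt_eqF //; lra.
rewrite mulrAC ler_pdivrMr // mulrAC [leRHS]mulrAC ler_pM2r ?invr_gt0; last by lra.
apply: le_trans (_ : (1 + N%:R * s) * (1 - (1 + N%:R * s)^-1) <= _).
  by rewrite mulrBr mulr1 divff ?gt_eqF; lra.
by rewrite ler_pM2l; lra.
Qed.

Lemma complete_bound_small : N%:R * s < 1 ->
  (1 - y) / (1 - y ^+ N) * N%:R <= (1 - N%:R * s / 2)^-1.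
Proof.
move=> X1; have s0 := s_gt0; have := N0 => N1.
have /andP[y0 y1] := y01.
have S : N%:R * (1 - N%:R * s / 2) <= \sum_(i < N) y ^+ i.
  apply: le_trans (_ : \sum_(i < N) (1 - i%:R * s) <= _).
    rewrite big_split /= sumr_const card_ord sumrN -mulr_suml sum_natr.
    have : 0 <= N%:R * s by rewrite mulr_ge0 ?ltW //; lra.
    lra.
  apply: ler_sum => i _; rewrite (_ : y = 1 - s * y); last first.
    by rewrite /y; field; rewrite gt_eqF //; lra.
  apply: le_trans (bernoulli_sub_ineq (x := s * y) i _).
    rewrite lerD2l lerN2 ler_wpM2l ?ler0n // ler_piMr ?ltW //.
  by apply/andP; split; nra.
have yS : 1 - y ^+ N = (1 - y) * \sum_(i < N) y ^+ i.
  by rewrite -[LHS]opprB subrX1 -mulNr opprB.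
have S0 : 0 < \sum_(i < N) y ^+ i.
  by apply: lt_le_trans S; rewrite mulr_gt0; lra.
rewrite yS (_ : (1 - y) / _ = (\sum_(i < N) y ^+ i)^-1); last first.
  by field; rewrite !gt_eqF //; lra.
rewrite [leLHS]mulrC ler_pdivrMr // [leRHS]mulrC ler_pdivlMr //; lra.
Qed.

Lemma geometric_upper : 1 - q ^+ n <= (1 - q) * n%:R *
  (1 - (40 * (n%:R * s) - 40 * s) / (2 * (1 + 40 * (n%:R * s)))).
Proof.
have s0 := s_gt0; have /andP[q0 q1] := q01.
have n0 : 0 <= n%:R :> R by rewrite ler0n.
have Y0 : 0 <= n%:R * s by apply: mulr_ge0 => //; exact: ltW.
have -> : 1 - q ^+ n = (1 - q) * \sum_(i < n) q ^+ i.
  by rewrite -[LHS]opprB subrX1 -mulNr opprB.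
rewrite -mulrA ler_pM2l; last by lra.
apply: le_trans (_ : \sum_(i < n) (1 - i%:R * (40 * s / (1 + 40 * (n%:R * s)))) <= _).
  apply: ler_sum => i _.
  have i0 : 0 <= i%:R :> R by rewrite ler0n.
  have is0 : 0 <= i%:R * s by apply: mulr_ge0 => //; exact: ltW.
  apply: le_trans (_ : (1 + i%:R * (40 * s))^-1 <= _).
    rewrite /q exprVn lef_pV2 ?posrE; first by apply: bernoulli_ineq; lra.
      by rewrite exprn_gt0; lra.
    by lra.
  have -> : (1 + i%:R * (40 * s))^-1 = 1 - i%:R * (40 * s / (1 + i%:R * (40 * s))).
    by field; rewrite gt_eqF; lra.
  rewrite lerD2l lerN2 ler_wpM2l // ler_wpM2l ?(mulr_ge0 _ (ltW s0)) //.
  rewrite lef_pV2 ?posrE; [|lra|lra].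
  have : i%:R * s <= n%:R * s by rewrite ler_pM2r // ler_nat ltnW.
  lra.
rewrite big_split /= sumr_const card_ord sumrN -mulr_suml sum_natr.
rewrite le_eqVlt; apply/orP; left; apply/eqP; field; rewrite gt_eqF //; lra.
Qed.

Lemma amplifier_comparison :
  (1 - y) / (1 - y ^+ N) * N%:R * (1 - q ^+ n + 40 * s * P)
    < (1 - s / 4) * (n%:R * (1 - q) + 40 * s * P).
Proof.
have s0 := s_gt0; have s1 := s_lt; have N1 := N0; have n1 := nN; have p0 := P_ge0; have p1 := P_le.
have /andP[q0 q1] := q01; have /andP[y0 y1] := y01.
have cE : 1 - q = 40 * s / (1 + 40 * s) by rewrite /q; field; rewrite gt_eqF //; lra.
have sP0 : 0 <= s * P by rewrite mulr_ge0 // ltW.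
have qn0 : 0 <= q ^+ n by rewrite exprn_ge0 // ltW.
have qn1 : q ^+ n <= 1 by rewrite exprn_ile1 // ltW.
have [X|X] := lerP (3 / 4) (N%:R * s).
  apply: le_lt_trans (_ : (1 + N%:R * s) / (1 + s) * (26 / 25) < _).
    apply: ler_pM => //; [| |exact: complete_bound_large | nra]; last by lra.
    by rewrite mulr_ge0 ?ler0n // divr_ge0 ?(ltW yN1) //; lra.
  apply: lt_le_trans (_ : (1 - s / 4) * (n%:R * (1 - q)) <= _); last first.
    by rewrite ler_pM2l; lra.
  rewrite cE; apply: lt_le_trans (_ : (1 - s / 4) * (24 / 100 * N%:R * (40 * s / (1 + 40 * s))) <= _); last first.
    rewrite ler_pM2l; last by lra.
    by rewrite ler_pM2r ?divr_gt0 //; lra.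
  rewrite mulrAC ltr_pdivrMr; last by lra.
  rewrite (_ : _ * (1 + s) = (1 - s / 4) * (48 / 5 * (N%:R * s)) * (1 + s) / (1 + 40 * s)); last first.
    by field; rewrite gt_eqF //; lra.
  rewrite ltr_pdivlMr; last by lra.
  set X0 := N%:R * s in X *; have sX : 40 * 100 * s <= X0 by rewrite ler_pM2r.
  have Xs : X0 * s <= X0 / 5 by nra.
  have Xss : X0 * s * s <= X0 * s / 5 by nra.
  have ss : s * s <= s / 5 by nra.
  nra.
set X0 := N%:R * s in X *.
have X0p : 0 < X0 by rewrite mulr_gt0 //; lra.
have sX : 40 * 100 * s <= X0 by rewrite ler_pM2r.
have B := geometric_upper; set Y := n%:R * s in B.
have YX : 24 * X0 <= 100 * Y by rewrite /X0 /Y; nra.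
have c0 : 0 < 1 - q by lra.
have cS : 40 * s <= (1 - q) * (101 / 100).
  rewrite cE mulrAC ler_pdivlMr; nra.
apply: le_lt_trans (_ : (1 - X0 / 2)^-1 * (1 - q ^+ n + 40 * s * P) < _).
  apply: ler_wpM2r; first by lra.
  by apply: complete_bound_small; rewrite -/X0; lra.
rewrite mulrC ltr_pdivrMr; last by lra.
set b := (_ - _) / _ in B.
have bge : 57 / 100 * X0 <= b.
  rewrite /b ler_pdivlMr; last by lra.
  have : X0 * Y <= 3 / 4 * Y by rewrite ler_wpM2r //; lra.
  lra.
set u := n%:R * (1 - q); set Q := 40 * s * P.
have n100 : 100 <= n%:R :> R by lra.
have u0 : 100 * (1 - q) <= u by rewrite ler_wpM2r // ltW.
have Q0 : 0 <= Q by rewrite /Q; lra.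
have Qc : Q <= 1 - q.
  apply: le_trans (_ : (1 - q) * (101 / 100) * P <= _); first exact: ler_wpM2r.
  by rewrite -mulrA ler_piMr //; lra.
have B' : 1 - q ^+ n <= u * (1 - 57 / 100 * X0).
  by apply: le_trans B _; rewrite [(1 - q) * _]mulrC -/u; apply: ler_wpM2l; lra.
have sX2 : 1 - 51 / 100 * X0 <= (1 - s / 4) * (1 - X0 / 2).
  have := mulr_gt0 s0 X0p; lra.
have uQ : 0 <= u + Q by lra.
have := ler_wpM2r uQ sX2.
have : X0 * Q < X0 * (u / 10) by rewrite ltr_pM2l //; lra.
have : 0 <= X0 * Q by apply: mulr_ge0 => //; exact: ltW.
move: (u) (Q) (q ^+ n) B' => u' Q' q' B'.
lra.
Qed.

End Comparison.

Lemma big_option (T : Type) (idx : T) (op : Monoid.com_law idx) (J : finType) (F : option J -> T) :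
  \big[op/idx]_(i : option J) F i = op (F None) (\big[op/idx]_(k : J) F (Some k)).
Proof.
rewrite (bigD1 None) //=; congr (op _ _).
rewrite (reindex_omap Some id) => [|[]//]; apply: eq_bigl => k.
by rewrite /= eqxx.
Qed.

Section LowerBound.
Variables (R : realType) (N n m : nat) (isl : 'I_N -> option 'I_n) (main : pred 'I_n) (s L : R).
Variable p : {set 'I_N} -> 'I_N -> 'I_N -> R.
Hypotheses (s_gt0 : 0 < s) (s_lt : s < 1 / 5) (m_le102 : (m <= 102)%N).
Hypotheses (L_ge : 100 * 100 * 100 <= L) (L_gen : n%:R <= L).
Hypotheses (N_ge : (40 * 100 <= N)%N) (main_ge : (24 * N <= 100 * #|main|)%N).
Hypothesis card_hub : #|island isl None| = m.
Hypothesis card_pair : forall k, #|island isl (Some k)| = 2%N.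

Let g := profile main s L.
Let psi := island_potential isl g.
Let q : R := (1 + 40 * s)^-1.
Let P : R := m%:R / (2 * L) + #|predC main|%:R / L ^+ 2.

Let L_gt0 : 0 < L. Proof. by have := L_ge; lra. Qed.

Let cE : 40 * s / (1 + 40 * s) = 1 - q.
Proof. by rewrite /q; field; rewrite gt_eqF //; have := s_gt0; lra. Qed.

Lemma profile0 i : g i 0 = 1.
Proof. by case: i => [k|] //=; rewrite /hub_sum big_ord0 mulr0 subr0. Qed.

Lemma potential0 : psi finset.set0 = 1.
Proof. by apply: big1 => i _; rewrite finset.setI0 cards0 profile0. Qed.

Lemma potential1 v : psi [set v] = g (isl v) 1.
Proof.
rewrite /psi /island_potential (bigD1 (isl v)) //= big1 ?mulr1.
  rewrite (_ : island _ _ :&: _ = [set v]) ?cards1 //.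
  by apply/setP => x; rewrite !inE; case: (x =P v) => [->|_]; rewrite ?eqxx ?andbF.
move=> i iv; rewrite (_ : _ :&: _ = finset.set0) ?cards0 ?profile0 //.
apply/setP => x; rewrite !inE; apply/negP => /andP[/eqP xi /eqP xv].
by rewrite -xi xv eqxx in iv.
Qed.

Lemma potentialT : psi [set: 'I_N]%SET =
  (1 - 40 * s / (2 * L) * hub_sum s m) *
  (q ^+ #|main| * (1 - 40 * s / L ^+ 2) ^+ #|predC main|).
Proof.
rewrite /psi /island_potential big_option finset.setIT card_hub; congr (_ * _).
under eq_bigr do rewrite finset.setIT card_pair.
rewrite (bigID main) /=; congr (_ * _).
  rewrite (eq_bigr (fun=> q)) => [|k ->]; last by rewrite cE subKr.
  by rewrite prodr_const.
rewrite (eq_bigr (fun=> 1 - 40 * s / L ^+ 2)) => [|k /negbTE -> //].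
by rewrite prodr_const.
Qed.

Lemma sum_potential1 : \sum_(v < N) (1 - psi [set v]) =
  40 * s * (m%:R / (2 * L)) +
  (1 - s / 4) * (#|main|%:R * (1 - q) + 40 * s * (#|predC main|%:R / L ^+ 2)).
Proof.
under eq_bigr do rewrite potential1.
rewrite (partition_big isl predT) //= big_option.
rewrite (eq_bigr (fun=> 40 * s / (2 * L))) => [|v /eqP ->]; last first.
  by rewrite /= /hub_sum big_ord_recl big_ord0 /= !mul0r !addr0 invr1 mulr1 subKr.
rewrite sumr_const (_ : #|_| = m); last first.
  by rewrite -[RHS]card_hub; apply: eq_card => v; rewrite !inE.
congr (_ + _); first by rewrite -[LHS]mulr_natr; ring.
have E k : \sum_(v < N | isl v == Some k) (1 - g (isl v) 1) =
    (if main k then 1 - q else 40 * s / L ^+ 2) * (1 - s / 4).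
  rewrite (eq_bigr (fun=> 1 - g (Some k) 1)) => [|v /eqP -> //].
  rewrite sumr_const (_ : #|_| = 2%N); last first.
    by rewrite -[RHS](card_pair k); apply: eq_card => v; rewrite !inE.
  by rewrite /= cE; case: ifP => _; rewrite mulr2n; field; rewrite // gt_eqF.
rewrite (eq_bigr _ (fun k _ => E k)) -mulr_suml mulrC; congr (_ * _).
rewrite (bigID main) /=; congr (_ + _).
  rewrite (eq_bigr (fun=> 1 - q)) => [|k -> //].
  by rewrite sumr_const -[LHS]mulr_natl.
rewrite (eq_bigr (fun=> 40 * s / L ^+ 2)) => [|k /negbTE -> //].
by rewrite sumr_const -[LHS]mulr_natl; ring.
Qed.

Let s40 : 0 < 40 * s. Proof. by have := s_gt0; lra. Qed.

Lemma others_bounds : 0 <= P <= 1 / 200.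
Proof.
have n0 : (#|predC main|%:R : R) <= n%:R by rewrite ler_nat -[leqRHS]card_ord max_card.
have L1 := L_ge; have L2 := L_gen; have L3 := L_gt0.
have m1 : m%:R <= 102%:R :> R by rewrite ler_nat.
have m0 : 0 <= m%:R :> R by rewrite ler0n.
have o0 : 0 <= #|predC main|%:R :> R by rewrite ler0n.
apply/andP; split.
  by rewrite /P addr_ge0 // divr_ge0 // ?mulr_ge0 ?exprn_ge0 // ltW.
have : m%:R / (2 * L) <= 1 / 400 by rewrite ler_pdivrMr ?mulr_gt0 //; lra.
have : #|predC main|%:R / L ^+ 2 <= 1 / 400.
  rewrite ler_pdivrMr ?exprn_gt0 // expr2 mulrA; apply: le_trans n0 _; apply: le_trans L2 _.
  by rewrite ler_peMl; lra.
by rewrite /P; lra.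
Qed.

Lemma potentialT_bounds : psi [set: 'I_N]%SET < 1 /\
  1 - psi [set: 'I_N]%SET <= 1 - q ^+ #|main| + 40 * s * P.
Proof.
have s0 := s_gt0; have s1 := s_lt; have L3 := L_gt0.
have L1 := L_ge; have LL : 100 * 100 * 100 <= L ^+ 2 by nra.
have sig := s40.
have main0 : (0 < #|main|)%N.
  rewrite lt0n; apply: contraTneq main_ge => ->.
  by rewrite muln0 -ltnNge muln_gt0 (leq_trans _ N_ge).
have q0 : 0 < q by rewrite invr_gt0; lra.
have q1 : q < 1 by rewrite invf_lt1; lra.
rewrite potentialT.
have /andP[] := hub_profile_bounds main s_gt0 m_le102 L_ge (leqnn m); rewrite /=.
have hm := hub_sum_le s_gt0 m.
have hG : 40 * s / (2 * L) * hub_sum s m <= 40 * s * (m%:R / (2 * L)).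
  rewrite -mulrA [_^-1 * _]mulrC ler_pM2l //.
  by rewrite ler_pM2r // invr_gt0 mulr_gt0.
set G := 1 - 40 * s / (2 * L) * _ => G1 G2.
set x := 40 * s / L ^+ 2.
have x0 : 0 <= x by rewrite divr_ge0 ?exprn_ge0 // ltW.
have x1 : x <= 1 by rewrite ler_pdivrMr ?exprn_gt0 //; lra.
have b : 1 - #|predC main|%:R * x <= (1 - x) ^+ #|predC main| by apply: bernoulli_sub_ineq; rewrite x0.
have b1 : (1 - x) ^+ #|predC main| <= 1 by rewrite exprn_ile1; lra.
have b0 : 0 <= (1 - x) ^+ #|predC main| by rewrite exprn_ge0; lra.
have Q0 : 0 <= q ^+ #|main| by rewrite exprn_ge0 // ltW.
have Q1 : q ^+ #|main| < 1 by rewrite exprn_ilt1 ?(ltW q0) // -lt0n.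
have PE : 40 * s * P = 40 * s * (m%:R / (2 * L)) + #|predC main|%:R * x.
  by rewrite /P /x; field; rewrite gt_eqF.
rewrite PE; move: b b1 b0 Q0 Q1; set B := _ ^+ _; set Q := _ ^+ _ => b b1 b0 Q0 Q1.
have hG' : 1 - G <= 40 * s * (m%:R / (2 * L)) by rewrite /G subKr.
have G0 : 0 <= G by lra.
have GB1 : G * B <= 1 by rewrite mulr_ile1.
have : 0 <= (1 - G) * (1 - B) by rewrite mulr_ge0 ?subr_ge0.
split; first by rewrite mulrCA; apply: le_lt_trans Q1; rewrite ler_piMr.
have : Q * (1 - G * B) <= 1 * (1 - G * B) by rewrite ler_wpM2r; lra.
lra.
Qed.

Hypothesis p_ge0 : forall S u v, 0 <= p S u v.
Hypothesis p_sum1 : forall S, \sum_(u < N) \sum_(v < N) p S u v = 1.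
Hypothesis p_irr : forall S, S != finset.set0 -> S != [set: 'I_N]%SET ->
  exists u v, [/\ u \in S, v \notin S & 0 < p S u v].
Hypothesis psi_super : forall S, repl_step p psi S <= psi S.

Lemma potential_lower_bound :
  (1 - (1 + s)^-1) / (1 - (1 + s)^-1 ^+ N) <
  N%:R^-1 * \sum_(v < N) fixprob (repl_step p) [set v].
Proof.
have N0 : (0 < N)%N by apply: leq_trans N_ge.
have [T1 T2] := potentialT_bounds; set D := 1 - psi [set: 'I_N]%SET in T2.
have D0 : 0 < D by rewrite subr_gt0.
pose phi S := (1 - psi S) / D.
have phi0 : phi finset.set0 <= 0 by rewrite /phi potential0 subrr mul0r.
have phiT : phi [set: 'I_N]%SET <= 1 by rewrite /phi divff // gt_eqF.
have phi_sub S : phi S <= repl_step p phi S.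
  have -> : repl_step p phi S = (1 - repl_step p psi S) / D.
    rewrite -[X in X - _](repl_step_cst p_sum1 1 S) /repl_step -sumrB mulr_suml.
    apply: eq_bigr => u _; rewrite -sumrB mulr_suml; apply: eq_bigr => v _.
    by rewrite /phi; ring.
  by rewrite ler_pM2r ?invr_gt0 // lerB.
have le v : phi [set v] <= fixprob (repl_step p) [set v].
  exact: (fixprob_subharmonic p_ge0 p_sum1 N0 p_irr phi0 phiT phi_sub).
have /andP[P0 P1] := others_bounds.
have cmp := amplifier_comparison s_gt0 s_lt N_ge main_ge P0 P1.
have : D * \sum_(v < N) phi [set v] <= D * \sum_(v < N) fixprob (repl_step p) [set v].
  by rewrite ler_pM2l //; apply: ler_sum => v _; apply: le.
rewrite {1}/phi -mulr_suml mulrCA divff ?gt_eqF // mulr1 sum_potential1.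
set F := \sum_(v < N) fixprob _ _ => leF.
rewrite [ltRHS]mulrC ltr_pdivlMr ?ltr0n //; set K := (1 - _) / _ in cmp *.
have K0 : 0 <= K * N%:R.
  have y0 : 0 < (1 + s)^-1 by rewrite invr_gt0; have := s_gt0; lra.
  have y1 : (1 + s)^-1 < 1 by rewrite invf_lt1; have := s_gt0; lra.
  rewrite mulr_ge0 // divr_ge0 ?subr_ge0 ?(ltW y1) //.
  by rewrite exprn_ile1 // ltW.
rewrite -(ltr_pM2l D0); apply: lt_le_trans leF.
rewrite [ltLHS]mulrC; apply: le_lt_trans (ler_wpM2l K0 T2) _; apply: lt_le_trans cmp _.
have : 0 <= 40 * s * (m%:R / (2 * L)).
  by rewrite mulr_ge0 ?(ltW s40) // divr_ge0 // mulr_ge0 // ltW.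
move=> h; have : 0 <= s * (40 * s * (m%:R / (2 * L))) by rewrite mulr_ge0 // ltW.
rewrite -/q /P; move: (_ / (2 * L)) (_ / L ^+ 2) (_ * (1 - q)) h => a b c h; lra.
Qed.

End LowerBound.

(** * The amplifier *)

Section Graph.
Variables (R : realType) (N n m : nat) (isl : 'I_N -> option 'I_n) (small : pred 'I_n) (L eps : R).
Hypotheses (m_gt100 : (100 < m)%N) (m_le102 : (m <= 102)%N).
Hypotheses (L_ge : 100 * 100 * 100 <= L) (L_gen : n%:R <= L).
Hypothesis N_ge : (40 * 100 <= N)%N.
Hypothesis card_hub : #|island isl None| = m.
Hypothesis card_pair : forall k, #|island isl (Some k)| = 2%N.
Hypothesis epsE : eps = (N%:R ^+ 4 * L ^+ 2)^-1.
Hypothesis small_ge : (24 * N <= 100 * #|small|)%N.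
Hypothesis large_ge : (24 * N <= 100 * #|predC small|)%N.

Definition hub (i : option 'I_n) : bool := i == None.

Definition target_deg (i : option 'I_n) : R :=
  match i with None => L | Some k => if small k then 1 else L ^+ 2 end.

Definition cross_deg (i : option 'I_n) : R :=
  \sum_(v < N | (isl v != i) && (hub i (+) hub (isl v))) eps.

(* The internal weights are tuned so that every node [u] has degree exactly
   [target_deg (isl u)]. *)
Definition internal_weight (i : option 'I_n) : R :=
  (target_deg i - cross_deg i) / (#|island isl i|%:R - 1).

Definition amplifier_w (u v : 'I_N) : R :=
  if u == v then 0
  else if isl u == isl v then internal_weight (isl u)
  else if hub (isl u) (+) hub (isl v) then eps else 0.

Local Notation w := amplifier_w.

Let L_gt0 : 0 < L. Proof. by have := L_ge; lra. Qed.
Let L_ge1 : 1 <= L. Proof. by have := L_ge; lra. Qed.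
Let L2_ge1 : 1 <= L ^+ 2. Proof. by rewrite exprn_ege1. Qed.
Let N_gt0 : (0 < N)%N. Proof. exact: leq_trans N_ge. Qed.
Let N_real : 40 * 100 <= N%:R :> R. Proof. by rewrite -natrM ler_nat. Qed.

Let eps_gt0 : 0 < eps.
Proof. by rewrite epsE invr_gt0 mulr_gt0 ?exprn_gt0 ?ltr0n. Qed.

Lemma eps_small : (N%:R + N%:R ^+ 2) * eps <= (100 ^+ 3 * L ^+ 2)^-1.
Proof.
have N1 := N_real; have N2 : 40 * 100 * (40 * 100) <= N%:R ^+ 2 :> R by rewrite expr2; nra.
have N0 : 0 < N%:R :> R by rewrite ltr0n.
rewrite epsE invfM [leRHS]invfM mulrA ler_pM2r ?invr_gt0 ?exprn_gt0 //.
rewrite ler_pdivrMr ?exprn_gt0 // ler_pdivlMl ?exprn_gt0 //.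
have -> : N%:R ^+ 4 = N%:R ^+ 2 * N%:R ^+ 2 :> R by rewrite -exprD.
have NN : N%:R <= N%:R ^+ 2 :> R by rewrite expr2; nra.
apply: le_trans (_ : 40 * 100 * (40 * 100) * N%:R ^+ 2 <= _).
  have : 0 <= N%:R ^+ 2 :> R by rewrite exprn_ge0.
  by move: (_ ^+ 2) NN => a; lra.
by rewrite ler_pM2r ?exprn_gt0.
Qed.

Lemma N_eps_small : N%:R * eps <= 1 / 4.
Proof.
apply: le_trans (_ : (N%:R + N%:R ^+ 2) * eps <= _).
  by rewrite ler_pM2r // lerDl exprn_ge0.
apply: le_trans eps_small _; rewrite -[X in _ <= X]invrK lef_pV2 ?posrE ?invr_gt0 ?mulr_gt0 ?exprn_gt0 //.
by have := L2_ge1; rewrite invf_div divr1; move: (_ ^+ 2) => a; lra.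
Qed.

Lemma target_deg_bounds i : 1 <= target_deg i <= L ^+ 2.
Proof.
have LL : L <= L ^+ 2 by rewrite expr2 ler_peMl // ltW.
by case: i => [k|] /=; [case: ifP => _|]; rewrite ?lexx ?L2_ge1 ?L_ge1 ?LL.
Qed.

Let target_deg_gt0 i : 0 < target_deg i.
Proof. by apply: lt_le_trans ltr01 _; case/andP: (target_deg_bounds i). Qed.

Lemma cross_deg_bounds i : 0 <= cross_deg i <= 1 / 4.
Proof.
rewrite sumr_ge0 => [|v _]; last exact: ltW.
by apply: le_trans N_eps_small; apply: sum_le_cst => //; apply: ltW.
Qed.

Lemma island_card_bounds i : 1 <= (#|island isl i|%:R : R) - 1 <= 101.
Proof.
have k2 : (2%:R : R) <= #|island isl i|%:R.
  by rewrite ler_nat; case: (i) => [k|]; rewrite ?card_pair ?card_hub // (leq_trans _ m_gt100).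
have k102 : (#|island isl i|%:R : R) <= 102%:R.
  by rewrite ler_nat; case: (i) => [k|]; rewrite ?card_pair ?card_hub.
by apply/andP; split; lra.
Qed.

Lemma internal_weight_ge i : target_deg i / 202 <= internal_weight i.
Proof.
have /andP[d1 _] := target_deg_bounds i; have /andP[_ c1] := cross_deg_bounds i.
have /andP[k1 k2] := island_card_bounds i.
rewrite /internal_weight ler_pdivlMr; last by lra.
have : target_deg i / 202 * (#|island isl i|%:R - 1) <= target_deg i / 202 * 101.
  by rewrite ler_wpM2l //; lra.
lra.
Qed.

Lemma internal_weight_le i : (#|island isl i|%:R - 1) * internal_weight i <= target_deg i.
Proof.
have /andP[c0 _] := cross_deg_bounds i; have /andP[k1 k2] := island_card_bounds i.
by rewrite /internal_weight mulrC divfK ?gt_eqF; lra.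
Qed.

Let internal_weight_gt0 i : 0 < internal_weight i.
Proof. by apply: lt_le_trans (internal_weight_ge i); rewrite divr_gt0. Qed.

Lemma amplifier_graph : weighted_graph w.
Proof.
split=> [u v|].
  rewrite /w; case: eqP => // _; case: eqP => _; first exact: ltW.
  by case: ifP => // _; apply: ltW.
split=> [u v|u]; rewrite /w ?eqxx // (eq_sym u) (eq_sym (isl u)) addbC.
by case: eqP => // _; case: eqP => // ->.
Qed.

Lemma amplifier_wdeg u : wdeg w u = target_deg (isl u).
Proof.
have /andP[k1 _] := island_card_bounds (isl u).
rewrite /wdeg (bigD1 u) //= {1}/w eqxx add0r.
rewrite (bigID (fun v => isl v == isl u)) /=.
rewrite (eq_bigr (fun=> internal_weight (isl u))); last first.
  by move=> v /andP[vu /eqP vI]; rewrite /w eq_sym (negbTE vu) vI eqxx.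
rewrite sumr_const.
have -> : #|(fun v => (v != u) && (isl v == isl u))| = #|island isl (isl u)|.-1.
  rewrite (cardsD1 u (island isl (isl u))) inE eqxx /=.
  by apply: eq_card => v; rewrite !inE.
have -> : \sum_(v < N | (v != u) && (isl v != isl u)) w u v = cross_deg (isl u).
  rewrite /cross_deg [RHS]big_mkcondr /=; apply: eq_big => [v|v /andP[vu vI]].
    by case: (v =P u) => [->|]; rewrite ?eqxx.
  by rewrite /w eq_sym (negbTE vu) eq_sym (negbTE vI).
have c0 : (0 < #|island isl (isl u)|)%N by rewrite card_gt0; apply/set0Pn; exists u; rewrite inE.
rewrite -[_ *+ _]mulr_natl -subn1 natrB // /internal_weight mulrC divfK ?subrK //.
by rewrite gt_eqF //; lra.
Qed.

Let wdeg_gt0 u : 0 < wdeg w u. Proof. by rewrite amplifier_wdeg. Qed.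

Lemma hub_dominates : exists h, forall v, v != h -> 0 < w h v.
Proof.
have : (0 < #|island isl None|)%N by rewrite card_hub (leq_trans _ m_gt100).
rewrite card_gt0 => /set0Pn[h]; rewrite inE => /eqP hI; exists h => v vh.
by rewrite /w eq_sym (negbTE vh) hI /hub eqxx addTb; case: (isl v) => [k|] /=; rewrite ?internal_weight_gt0.
Qed.

Lemma amplifier_connected : connected_wg w.
Proof.
have [h hv] := hub_dominates; have [_ [ws _]] := amplifier_graph.
have hc v : connect (fun x y => 0 < w x y) h v.
  by have [->|vh] := eqVneq v h; [exact: connect0 | apply: connect1; exact: hv].
have ch u : connect (fun x y => 0 < w x y) u h.
  by have [->|vh] := eqVneq u h; [exact: connect0 | apply: connect1; rewrite ws; exact: hv].
by move=> u v; apply: connect_trans (ch u) (hc v).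
Qed.

Lemma cut_edge (S : {set 'I_N}) : S != finset.set0 -> S != [set: 'I_N]%SET ->
  exists u v, [/\ u \in S, v \notin S & 0 < w u v].
Proof.
have [h hv] := hub_dominates; have [_ [ws _]] := amplifier_graph.
move=> S0 ST; have [hS|hS] := boolP (h \in S).
  have /subsetPn[v _ vS] : ~~ ([set: 'I_N]%SET \subset S) by rewrite finset.subTset.
  by exists h, v; split => //; apply: hv; apply: contraNneq vS => ->.
have /set0Pn[u uS] := S0; exists u, h; split => //; rewrite ws; apply: hv.
by apply: contraNneq hS => <-.
Qed.

Variable s : R.
Hypotheses (s_gt0 : 0 < s) (s_lt : s < 1 / 5).

Let island_sizeE i : #|island isl i| = island_size m i.
Proof. by case: i. Qed.

Lemma amplifier_superharmonic (main : pred 'I_n) (p : {set 'I_N} -> 'I_N -> 'I_N -> R)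
    (Z : {set 'I_N} -> R) (W : 'I_N -> 'I_N -> R) (kappa : {set 'I_N} -> 'I_N -> R) :
  (forall S u v, 0 <= p S u v) ->
  (forall S, \sum_(u < N) \sum_(v < N) p S u v = 1) ->
  (forall S u v, p S u v = Z S * (fit (1 + s) S u * W u v * kappa S v / repro main L (isl v))) ->
  (forall S, 0 <= Z S) -> (forall u v, 0 <= W u v) -> (forall u v, W u v = W v u) ->
  (forall u v, W u v <= w u v) ->
  (forall u v, u != v -> isl u = isl v -> (202 * L ^+ 2)^-1 <= W u v) ->
  (forall S v, (1 + s)^-1 <= kappa S v) -> (forall S v, kappa S v <= 1) ->
  (forall (S : {set 'I_N}) u v, isl u = isl v -> u \in S -> v \notin S ->
     kappa S u <= (1 + s / (#|island isl (isl v)|%:R - 1)) * kappa S v) ->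
  (forall (S : {set 'I_N}) v, island isl (isl v) :&: S = finset.set0 -> (1 + s / 4)^-1 <= kappa S v) ->
  forall S, repl_step p (island_potential isl (profile main s L)) S
    <= island_potential isl (profile main s L) S.
Proof.
move=> p0 p1 pE Z0 W0 Ws Wle Wint k1 k2 k3 k4.
have s0 := s_gt0.
have sE : 1 + s - 1 = s by ring.
apply: (@island_potential_superharmonic R N _ isl hub (profile main s L) (repro main L)
  _ _ (1 + s) (1 + s / 4)^-1 (61 * (40 * s * s)) (40 * s * s / 30) eps (202 * L ^+ 2)^-1
  p Z W kappa) => //.
- by apply: repro_gt0.
- move=> i j; rewrite island_sizeE => ji.
  exact: (profile_gt0 main s_gt0 s_lt m_le102 L_ge ji).
- by lra.
- by rewrite !mulr_ge0 // ltW.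
- by rewrite !mulr_ge0 ?invr_ge0 // ltW.
- exact: ltW.
- move=> i j; rewrite island_sizeE => ji.
  by have [] := gain_lower main s_gt0 s_lt m_le102 L_ge ji.
- move=> i j; rewrite island_sizeE => ji.
  by have [] := loss_upper main s_gt0 s_lt m_le102 L_ge ji.
- move=> i i' j j'; rewrite !island_sizeE => ji ji'.
  have [_ g1] := gain_lower main s_gt0 s_lt m_le102 L_ge ji.
  have [_ l1] := loss_upper main s_gt0 s_lt m_le102 L_ge ji'.
  by apply: le_trans (lerB l1 g1) _; lra.
- move=> i j; rewrite sE !island_sizeE => ji.
  exact: (internal_decrease main s_gt0 s_lt m_gt100 m_le102 L_ge ji).
- move=> i i' hi; rewrite island_sizeE.
  exact: (homogeneous_decrease main s_gt0 s_lt m_gt100 m_le102 L_ge hi).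
- move=> u v uv; apply: le_trans (Wle u v) _; rewrite /w.
  have [/eqP|_] := eqVneq u v; first by move=> /eqP e; rewrite e eqxx in uv.
  by rewrite (negbTE uv); case: ifP => // _; apply: ltW.
- move=> u v uv nh; apply/eqP; rewrite eq_le W0 andbT; apply: le_trans (Wle u v) _; rewrite /w.
  by case: eqP => // _; rewrite (negbTE uv) (negbTE nh).
- by rewrite invr_ge0 mulr_ge0 // exprn_ge0 // ltW.
- by move=> S u v; rewrite sE; apply: k3.
have es := eps_small; have ss : 0 < 40 * s * s by rewrite !mulr_gt0.
have L2 : 0 < (L ^+ 2)^-1 by rewrite invr_gt0 exprn_gt0.
rewrite mulrA invfM; rewrite invfM in es.
apply: le_trans (ler_wpM2r _ es) _; first by rewrite mulr_ge0 // ltW.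
move: ss L2; move: (40 * s * s) ((L ^+ 2)^-1) => b c b0 c0.
have : 0 < c * b by rewrite mulr_gt0.
lra.
Qed.

Lemma amplifier_Bd : (1 - (1 + s)^-1) / (1 - (1 + s)^-1 ^+ N) < rho_Bd (1 + s) w.
Proof.
have s0 := s_gt0; have r1 : 1 <= 1 + s by lra.
have gr := amplifier_graph; have [w0 [ws _]] := gr.
have p0 := @Bd_kernel_ge0 _ _ _ _ r1 gr wdeg_gt0.
have p1 S := @Bd_kernel_sum _ _ _ w r1 wdeg_gt0 S N_gt0.
have F0 S : 0 < total_fit (1 + s) S := total_fit_gt0 r1 S N_gt0.
have f0 S u : 0 < fit (1 + s) S u := lt_le_trans ltr01 (fit_ge1 r1 S u).
apply: (potential_lower_bound s_gt0 s_lt m_le102 L_ge L_gen N_ge small_ge card_hub card_pair p0 p1).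
  move=> S S0 ST; have [u [v [uS vS uv]]] := cut_edge S0 ST; exists u, v; split => //.
  by rewrite !mulr_gt0 ?invr_gt0.
have d1 i : 1 <= target_deg i by case/andP: (target_deg_bounds i).
apply: (@amplifier_superharmonic small (Bd_kernel (1 + s) w)
    (fun S => (2 * total_fit (1 + s) S)^-1)
    (fun u v => w u v / (target_deg (isl u) * target_deg (isl v))) (fun=> fun=> 1)) => //.
- move=> S u v; rewrite /Bd_kernel amplifier_wdeg.
  have -> : repro small L (isl v) = (2 * target_deg (isl v))^-1.
    by case: (isl v) => [k|] //=; case: ifP => // _; rewrite mulr1.
  by field; rewrite !gt_eqF.
- by move=> S; rewrite invr_ge0 mulr_ge0 // ltW.
- by move=> u v; rewrite divr_ge0 // mulr_ge0 // ltW.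
- by move=> u v; rewrite ws [target_deg _ * _]mulrC.
- move=> u v; rewrite ler_pdivrMr ?mulr_gt0 // ler_peMr //.
  by rewrite mulr_ege1.
- move=> u v uv I; rewrite /w (negbTE uv) I eqxx.
  have iw := internal_weight_ge (isl v); have /andP[_ d2] := target_deg_bounds (isl v).
  have d0 := target_deg_gt0 (isl v).
  rewrite ler_pdivlMr ?mulr_gt0 //; apply: le_trans iw.
  rewrite ler_pdivrMl ?mulr_gt0 ?exprn_gt0 //.
  rewrite (_ : 202 * L ^+ 2 * _ = L ^+ 2 * target_deg (isl v)) ?ler_pM2r //.
  by field.
- by move=> S v; rewrite invf_le1 //; lra.
- move=> S u v _ _ _; have /andP[k1 _] := island_card_bounds (isl v).
  by rewrite mulr1 lerDl divr_ge0 ?(ltW s0) //; lra.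
- by move=> S v _; rewrite invf_le1; lra.
Qed.

Lemma amplifier_dB_weight_internal (S : {set 'I_N}) u v :
  isl u = isl v -> u \in S -> v \notin S ->
  dB_weight (1 + s) w S v = dB_weight (1 + s) w S u + s * internal_weight (isl v).
Proof.
move=> I uS vS; have uv : u != v by apply: contraNneq vS => <-.
have [_ [ws w0]] := amplifier_graph.
have wuv : w u v = internal_weight (isl v) by rewrite /w (negbTE uv) I eqxx.
rewrite /dB_weight (bigD1 u) // [in RHS](bigD1 u) //= (bigD1 v) 1?eq_sym // [in RHS](bigD1 v) 1?eq_sym //=.
rewrite !w0 /fit uS (negbTE vS) (ws v u) wuv.
rewrite (eq_bigr (fun z => (if z \in S then 1 + s else 1) * w z u)) => [|z /andP[zu zv]]; first by ring.
by congr (_ * _); rewrite /w (negbTE zu) (negbTE zv) I.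
Qed.

Lemma amplifier_dB : (1 - (1 + s)^-1) / (1 - (1 + s)^-1 ^+ N) < rho_dB (1 + s) w.
Proof.
have s0 := s_gt0; have s1 := s_lt; have r1 : 1 <= 1 + s by lra.
have gr := amplifier_graph; have [w0 [ws _]] := gr.
have p0 := @dB_kernel_ge0 _ _ _ _ r1 gr wdeg_gt0.
have p1 S := @dB_kernel_sum _ _ _ w r1 gr wdeg_gt0 S N_gt0.
have D0 S u : 0 < dB_weight (1 + s) w S u := dB_weight_gt0 r1 gr wdeg_gt0 S u.
have f0 S u : 0 < fit (1 + s) S u := lt_le_trans ltr01 (fit_ge1 r1 S u).
have d0 := target_deg_gt0.
rewrite /rho_dB dB_stepE.
apply: (potential_lower_bound s_gt0 s_lt m_le102 L_ge L_gen N_ge large_ge card_hub card_pair p0 p1).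
  move=> S S0 ST; have [u [v [uS vS uv]]] := cut_edge S0 ST; exists u, v; split => //.
  by rewrite !mulr_gt0 ?invr_gt0 ?ltr0n.
apply: (@amplifier_superharmonic (predC small) (dB_kernel (1 + s) w)
    (fun S => (2 * L ^+ 2 * N%:R)^-1) w
    (fun S v => target_deg (isl v) / dB_weight (1 + s) w S v)) => //.
- move=> S u v; rewrite /dB_kernel.
  have -> : repro (predC small) L (isl v) = target_deg (isl v) / (2 * L ^+ 2).
    case: (isl v) => [k|] /=; last by field; rewrite gt_eqF.
    by case: (small k) => /=; field; rewrite gt_eqF.
  field; rewrite !gt_eqF //= ?ltr0n //; exact: D0.
- by move=> S; rewrite invr_ge0 !mulr_ge0 ?exprn_ge0 // ltW.
- move=> u v uv I; rewrite /w (negbTE uv) I eqxx.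
  apply: le_trans (internal_weight_ge (isl v)); rewrite invfM mulrC ler_pM2r ?invr_gt0 //.
  have /andP[d1 _] := target_deg_bounds (isl v); apply: le_trans d1.
  by rewrite invf_le1 ?exprn_gt0.
- move=> S v; rewrite ler_pdivlMr // ler_pdivrMl; last by lra.
  by rewrite -amplifier_wdeg; apply: dB_weight_le.
- by move=> S v; rewrite ler_pdivrMr // mul1r -amplifier_wdeg; apply: dB_weight_ge.
- move=> S u v I uS vS; rewrite I mulrCA ler_pM2l // ler_pdivlMr // mulrC ler_pdivrMr //.
  rewrite (amplifier_dB_weight_internal I uS vS) mulrDl mul1r lerD2l.
  have /andP[k1 _] := island_card_bounds (isl v).
  rewrite -[leRHS]mulrA ler_pM2l // [leRHS]mulrC ler_pdivlMr; last by lra.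
  rewrite [leLHS]mulrC; apply: le_trans (internal_weight_le _) _; rewrite -I -amplifier_wdeg.
  exact: dB_weight_ge.
move=> S v SI; rewrite ler_pdivlMr // mulrC ler_pdivrMr; last by lra.
have -> : dB_weight (1 + s) w S v =
    target_deg (isl v) + \sum_(z < N) (fit (1 + s) S z - 1) * w z v.
  rewrite -amplifier_wdeg /wdeg /dB_weight -big_split /=; apply: eq_bigr => z _.
  by rewrite (ws v z); ring.
have /andP[d1 _] := target_deg_bounds (isl v).
have : \sum_(z < N) (fit (1 + s) S z - 1) * w z v <= N%:R * (s * eps).
  apply: sum_le_cst => [|z _]; first by rewrite mulr_ge0 ?ltW.
  rewrite /fit; case: ifP => zS; last by rewrite subrr mul0r mulr_ge0 ?ltW.
  rewrite (_ : 1 + s - 1 = s) ?ler_pM2l //; last by ring.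
  rewrite /w; case: eqP => _; first exact: ltW.
  case: eqP => [zv|_]; last by case: ifP => // _; apply: ltW.
  by have := finset.in_set0 z; rewrite -SI !inE zv eqxx zS.
have := ler_wpM2l (ltW s0) N_eps_small; nra.
Qed.

End Graph.

Lemma card_ord_lt n k : (k <= n)%N -> #|[pred i : 'I_n | (i < k)%N]| = k.
Proof.
by move=> kn; rewrite -sum1_card (big_ord_narrow kn) sum_nat_const card_ord muln1.
Qed.

Section Partition.
Variables (N n m : nat).
Hypothesis N_eq : N = (m + n.*2)%N.

Definition node_island (u : 'I_N) : option 'I_n :=
  if (u < m)%N then None else insub (u - m)./2.

Lemma node_island_hub u : (node_island u == None) = (u < m)%N.
Proof.
rewrite /node_island; case: ltnP => // mu; case: insubP => //= /negP[].
by have := ltn_ord u; lia.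
Qed.

Lemma node_island_pair u k :
  (node_island u == Some k) = (u == m + k.*2 :> nat)%N || (u == (m + k.*2).+1 :> nat)%N.
Proof.
rewrite /node_island; case: ltnP => mu.
  by apply/esym/negbTE; rewrite negb_or; move: mu; lia.
case: insubP => [j _ jE|/negP[]]; last by have := ltn_ord u; lia.
by rewrite (_ : (Some j == Some k) = (val j == val k)) // jE /=; lia.
Qed.

Lemma card_node_hub : #|island node_island None| = m.
Proof.
have mN : (m <= N)%N by rewrite N_eq leq_addr.
by rewrite -[RHS](card_ord_lt mN); apply: eq_card => u; rewrite !inE node_island_hub.
Qed.

Lemma card_node_pair k : #|island node_island (Some k)| = 2%N.
Proof.
have k1 : (m + k.*2 < N)%N by have := ltn_ord k; lia.
have k2 : ((m + k.*2).+1 < N)%N by have := ltn_ord k; lia.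
rewrite (_ : island _ _ = [set Ordinal k1; Ordinal k2]).
  by rewrite cards2 -val_eqE /= neq_ltn ltnSn.
by apply/setP => u; rewrite !inE node_island_pair -!val_eqE.
Qed.

End Partition.

Theorem theorem3 (R : realType) :
  exists N0 : nat, forall N : nat, (N0 <= N)%N ->
    exists w : 'I_N -> 'I_N -> R,
      weighted_graph w /\ connected_wg w /\
      forall r : R, 1 < r -> r < 6 / 5 ->
        rho_Bd r (@complete_w R N) < rho_Bd r w /\
        rho_dB r (@complete_w R N) < rho_dB r w.
Proof.
exists (40 * 100)%N => N N_ge.
pose m : nat := if odd N then 101%N else 102%N.
have m_gt : (100 < m)%N by rewrite /m; case: ifP.
have m_le : (m <= 102)%N by rewrite /m; case: ifP.
pose n := (N - m)./2.
have mN : (m <= N)%N by rewrite (leq_trans m_le) // (leq_trans _ N_ge).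
have N_eq : N = (m + n.*2)%N.
  rewrite /n; have := odd_double_half (N - m); rewrite oddB // (_ : odd N (+) odd m = false).
    by rewrite add0n => ->; rewrite subnKC.
  by rewrite /m; case: (odd N).
pose small : pred 'I_n := [pred k : 'I_n | (k < n./2)%N].
have small_card : #|small| = n./2 by apply: card_ord_lt; lia.
have large_card : #|predC small| = (n - n./2)%N.
  have := cardC small; rewrite small_card card_ord => e.
  by apply/eqP; rewrite -(eqn_add2l n./2) subnKC ?leq_half //; [apply/eqP | lia].
have small_ge : (24 * N <= 100 * #|small|)%N by rewrite small_card; lia.
have large_ge : (24 * N <= 100 * #|predC small|)%N by rewrite large_card; lia.
pose L : R := 100 * 10 * N%:R.
have NR : 40 * 100 <= N%:R :> R by rewrite -natrM ler_nat.
have L_ge : 100 * 100 * 100 <= L by rewrite /L; lra.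
have L_gen : n%:R <= L.
  have : n%:R <= N%:R :> R by rewrite ler_nat; lia.
  by rewrite /L; lra.
pose eps : R := (N%:R ^+ 4 * L ^+ 2)^-1.
have hub_card := card_node_hub N_eq; have pair_card := card_node_pair N_eq.
exists (amplifier_w (@node_island N n m) small L eps).
split; first by apply: (@amplifier_graph _ N n m).
split; first by apply: (@amplifier_connected _ N n m).
move=> r r1 r2; pose s := r - 1.
have s0 : 0 < s by rewrite /s; lra.
have s1 : s < 1 / 5 by rewrite /s; lra.
have -> : r = 1 + s by rewrite /s; ring.
have N1 : (1 < N)%N by apply: leq_trans N_ge.
have r1' : 1 < 1 + s by lra.
split.
  apply: le_lt_trans (rho_Bd_complete_le r1' N1) _.
  by apply: (@amplifier_Bd _ N n m).
apply: le_lt_trans (rho_dB_complete_le r1' N1) _.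
by apply: (@amplifier_dB _ N n m).
Qed.
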